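(* Let $(X_k,\Phi_k^{(1)},\dots,\Phi_k^{(M)})$, $k\ge1$, be independent copies of the mixture process $X$ observed on $[0,T]$, $0<T<\infty$, together with its regime indicators $(\Phi^{(1)},\dots,\Phi^{(M)})$, and consider the maximum likelihood estimators $$\widehat{\pi}_{N,i}=\frac1N\sum_{k=1}^N B_i^{(k)},\qquad \widehat{q}_{N,ij}^{(m)}=\frac{\sum_{k=1}^N\Phi_k^{(m)}N_{ij}^{(k)}}{\sum_{k=1}^N\Phi_k^{(m)}Z_i^{(k)}},$$ $$\widehat{q}_{N,i}^{(m)}=\frac{\sum_{k=1}^N\Phi_k^{(m)}N_{i}^{(k)}}{\sum_{k=1}^N\Phi_k^{(m)}Z_i^{(k)}},\qquad \widehat{s}_{N,i}^{(m)}=\frac{\sum_{k=1}^N\Phi_k^{(m)}B_i^{(k)}}{\sum_{k=1}^N B_i^{(k)}}.$$ If $\mathbb{P}\{X(t)=i\}>0$ for $i=1,\dots,p$ and $t\ge0$, then, with probability one, $$\lim_{N\to\infty}\widehat{q}_{N,ij}^{(m)}=q_{ij}^{(m)}\ (j\neq i),\qquad \lim_{N\to\infty}\widehat{q}_{N,i}^{(m)}=q_i^{(m)},\qquad \lim_{N\to\infty}\widehat{s}_{N,i}^{(m)}=s_i^{(m)},\qquad \lim_{N\to\infty}\widehat{\pi}_{N,i}=\pi_i,$$ for all $i,j=1,\dots,p$ and $m=1,\dots,M$.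
   Context: State space $\mathbb{S}=\{1,\dots,p\}$, $M$ regimes. The mixture process $X$ starts in state $i$ with probability $\pi_i$; given initial state $i$, it selects regime $\phi=m$ with probability $s_i^{(m)}=\mathbb{P}\{\phi=m\mid X(0)=i\}$, where $0\le s_i^{(m)}\le1$ and $\sum_{m=1}^M s_i^{(m)}=1$; given the initial state and $\phi=m$ it evolves as a right-continuous Markov jump process on $\mathbb{S}$ with intensity matrix $\mathbf{Q}^{(m)}=(q_{ij}^{(m)})$, where $q_{ii}^{(m)}\le 0$, $q_{ij}^{(m)}\ge0$ for $j\ne i$ and $\sum_{j\neq i}q_{ij}^{(m)}=-q_{ii}^{(m)}=q_i^{(m)}$. $\Phi^{(m)}=\mathbb{1}_{\{\phi=m\}}$, and $\Phi_k^{(m)}$ is the corresponding indicator for $X_k$ (complete observation: the regime driving each $X_k$ is known). $B_i^{(k)}=\mathbb{1}_{\{X_k(0)=i\}}$; $N_{ij}^{(k)}$ is the number of transitions of $X_k$ from state $i$ to state $j\neq i$ during $[0,T]$; $N_i^{(k)}=\sum_{j\neq i}N_{ij}^{(k)}$; $Z_i^{(k)}=\int_0^T\mathbb{1}_{\{X_k(u)=i\}}\,du$ is the occupation time of state $i$ on $[0,T]$.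
   Formalization: The limits of the rate estimators q̂_ij^(m) and q̂_i^(m) are claimed only for pairs (m,i) with P{X(t)=i, φ=m}>0 for some t in [0,T); otherwise their denominator is almost surely 0 for every N and they are the undefined 0/0. *)

(* Defs.v *)
From HB Require Import structures.
From mathcomp Require Import all_boot all_order all_algebra finmap.
From mathcomp Require Import all_classical all_reals all_analysis.

Set Implicit Arguments.
Unset Strict Implicit.
Unset Printing Implicit Defensive.

Import Order.TTheory GRing.Theory Num.Theory.
Import numFieldNormedType.Exports.

Local Open Scope classical_set_scope.
Local Open Scope ring_scope.

(* States are 'I_p and regimes are 'I_M, numbered from 0. *)

Section Rates.
Context {R : realType}.

Definition is_intensity (p : nat) (Q : 'M[R]_p) : Prop :=
  [/\ forall i, Q i i <= 0,
      forall i j, j != i -> 0 <= Q i j &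
      forall i, \sum_(j | j != i) Q i j = - Q i i].

Definition exit_rate (p : nat) (Q : 'M[R]_p) (i : 'I_p) : R := - Q i i.

Definition is_regime_law (p M : nat) (s : 'I_p -> 'I_M -> R) : Prop :=
  (forall i m, 0 <= s i m <= 1) /\ (forall i, \sum_m s i m = 1).

Definition expmx (p : nat) (A : 'M[R]_p) : 'M[R]_p :=
  \matrix_(i, j) limn (fun n => \sum_(0 <= k < n) (A ^+ k) i j / k`!%:R).

End Rates.

Section Paths.
Context {R : realType} {p : nat}.

(* A path is only meaningful at nonnegative times.  Since 'I_p is discrete, a
   right-continuous path with left limits is a step function with finitely many
   jumps on each bounded interval. *)
Definition jump_path (x : R -> 'I_p) : Prop :=
  (forall t, 0 <= t -> \forall u \near t^'+, x u = x t) /\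
  (forall t, 0 < t -> exists i, \forall u \near t^'-, x u = i).

Definition jump_times (x : R -> 'I_p) (T : R) (i j : 'I_p) : set R :=
  [set t | [/\ 0 < t, t <= T, \forall u \near t^'-, x u = i & x t = j]].

(* [fset_set] sends an infinite set to the empty one; the sets of jump times of
   a [jump_path] on [0, T] are finite (for j != i). *)
Definition transitions (x : R -> 'I_p) (T : R) (i j : 'I_p) : nat :=
  #|` fset_set (jump_times x T i j)|%fset.

Definition exits (x : R -> 'I_p) (T : R) (i : 'I_p) : nat :=
  (\sum_(j | j != i) transitions x T i j)%N.

Definition occupation_time (x : R -> 'I_p) (T : R) (i : 'I_p) : R :=
  \int[lebesgue_measure]_(u in `[0, T]) (x u == i)%:R.

End Paths.

Section Processes.
Context {R : realType} {d : measure_display} {Omega : measurableType d}.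
Context {p M : nat} (P : probability Omega R).
Implicit Types (X : R -> Omega -> 'I_p) (phi : Omega -> 'I_M).

(* On the event E, and given the initial state, X has the finite-dimensional
   distributions of the Markov process with transition matrices exp(t Q).  The
   conditional probabilities given E and X(0) are cleared of their denominators,
   so that null conditioning events need no convention. *)
Definition markov_given (E : set Omega) X (Q : 'M[R]_p) : Prop :=
  forall (n : nat) (t : nat -> R) (i : nat -> 'I_p),
    t 0%N = 0 -> (forall l, (l < n)%N -> t l < t l.+1) ->
    P (E `&` [set w | forall l, (l <= n)%N -> X (t l) w = i l]) =
    (P (E `&` [set w | X 0%R w = i 0%N]) *
     (\prod_(l < n) expmx ((t l.+1 - t l) *: Q) (i l) (i l.+1))%:E)%E.

(* [phi] is the regime selected by X; the indicator Phi^(m) is [phi w == m]. *)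
Record mixture_process (pi_ : 'I_p -> R) (s : 'I_p -> 'I_M -> R)
    (Q : 'I_M -> 'M[R]_p) X phi : Prop := MixtureProcess {
  mixture_measurable_state : forall t i, 0 <= t ->
    measurable [set w | X t w = i];
  mixture_measurable_regime : forall m, measurable [set w | phi w = m];
  mixture_path : forall w, jump_path (fun t => X t w);
  mixture_initial : forall i, P [set w | X 0 w = i] = (pi_ i)%:E;
  mixture_regime : forall i m,
    P [set w | X 0 w = i /\ phi w = m] =
    ((s i m)%:E * P [set w | X 0%R w = i])%E;
  mixture_markov : forall m, markov_given [set w | phi w = m] X (Q m) }.

(* The sigma-algebra generated by the variables X(t), t >= 0, and phi. *)
Definition observed_sigma X phi : set (set Omega) :=
  <<s [set A | (exists t i, 0 <= t /\ A = [set w | X t w = i]) \/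
               (exists m, A = [set w | phi w = m])] >>.

Definition mutually_independent (F : nat -> set (set Omega)) : Prop :=
  forall (J : {fset nat}) (A : nat -> set Omega),
    (forall k, k \in J -> F k (A k)) ->
    P (\bigcap_(k in [set` J]) A k) = (\prod_(k <- J) P (A k))%E.

End Processes.

(* The sample is indexed from 0: a sample of size N consists of the copies
   0, ..., N - 1. *)
Section Estimators.
Context {R : realType} {d : measure_display} {Omega : measurableType d}.
Context {p M : nat}.
Variables (X : nat -> R -> Omega -> 'I_p) (phi : nat -> Omega -> 'I_M) (T : R).

Definition initial_total (N : nat) (i : 'I_p) (w : Omega) : R :=
  \sum_(k < N) (X k 0 w == i)%:R.

Definition occupation_total (N : nat) (m : 'I_M) (i : 'I_p) (w : Omega) : R :=
  \sum_(k < N)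
    (phi k w == m)%:R * occupation_time (fun t => X k t w) T i.

Definition pi_hat (N : nat) (i : 'I_p) (w : Omega) : R :=
  N%:R^-1 * initial_total N i w.

Definition q_hat (N : nat) (m : 'I_M) (i j : 'I_p) (w : Omega) : R :=
  (\sum_(k < N)
    (phi k w == m)%:R * (transitions (fun t => X k t w) T i j)%:R) /
  occupation_total N m i w.

Definition q_exit_hat (N : nat) (m : 'I_M) (i : 'I_p) (w : Omega) : R :=
  (\sum_(k < N) (phi k w == m)%:R * (exits (fun t => X k t w) T i)%:R) /
  occupation_total N m i w.

Definition s_hat (N : nat) (m : 'I_M) (i : 'I_p) (w : Omega) : R :=
  (\sum_(k < N) (phi k w == m)%:R * (X k 0 w == i)%:R) / initial_total N i w.

End Estimators.

(* Main.v *)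
Require Import Defs.
From HB Require Import structures.
From mathcomp Require Import all_boot all_order all_algebra finmap.
From mathcomp Require Import all_classical all_reals all_analysis.
From mathcomp Require Import measurable_realfun.
From mathcomp Require Import ring lra zify.

Set Implicit Arguments.
Unset Strict Implicit.
Unset Printing Implicit Defensive.

Import Order.TTheory GRing.Theory Num.Theory.
Import numFieldNormedType.Exports.

Local Open Scope classical_set_scope.
Local Open Scope ring_scope.

(** Each estimator is a ratio of two empirical means, so the theorem follows
    from strong laws of large numbers for the indicators of the initial state,
    for the occupation times Phi^(m) Z_i and for the transition counts
    Phi^(m) N_ij, together with the identity of means

      E[Phi^(m) N_ij] = q_ij^(m) E[Phi^(m) Z_i],      j != i,

    and the strict positivity of E[Phi^(m) Z_i].

    The processes are known only through their finite-dimensional laws, so all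
    probabilistic facts are obtained on the regular grid of mesh h = T/(n+1) and
    passed to the limit.  For a fixed path the jump times do not accumulate, so
    that for small h each cell holds at most one jump: the number of cells seen
    to go from i to j is then exactly N_ij (transitions_grid), while h times the
    number of grid points in state i tends to Z_i by right-continuity
    (occupation_grid).  Both approximations are finite sums of indicators of
    events of the generated sigma-algebra of the copy, so their means, their
    second moments and the products between two copies are sums of
    probabilities.

    The Markov property (markov_step) makes the expected number of cells going
    from i to j equal to e_ij(h) sum_l P(phi = m, X(lh) = i), where
    e(h) = exp(hQ) satisfies e_ij(h)/h --> q_ij (expmx_rate); comparison with
    the Riemann sums h sum_l P(phi = m, X(lh) = i) --> E[Phi^(m) Z_i] gives the
    identity of means.  The same property bounds the second moments of the grid
    counts by u + u^2 with u = (n+1)|e_ij(h)| bounded (regime_jump_sq_le).  This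
    bound makes the means of the grid counts converge to the mean of the
    limit (limit_of_means), and Fatou's lemma carries the second moment bound and
    the absence of positive correlation between copies to the limit.  These are
    the hypotheses of the square-integrable strong law (strong_law), whose
    combination with grid approximation is strong_law_limit_count.

    Finally E[Phi^(m) Z_i] > 0 because a right-continuous path that is in state
    i at some t < T stays there for a positive time, and s_i^(m), pi_i come out
    of the law of X(0) and phi, with pi_i > 0. *)

(** * The strong law of large numbers under bounded second moments *)

Section MeanSquares.
Context {R : realType}.

(** If r^2 <= N < (r+1)^2, monotonicity squeezes S N / N between
    S (r^2) / (r+1)^2 and S ((r+1)^2) / r^2, which differ from the means at the
    squares by factors (r / (r+1))^(+-2) that tend to 1. *)
Lemma cvg_sandwich_squares (S : nat -> R) (mu : R) :
  {homo S : m n / (m <= n)%N >-> m <= n} -> (forall n, 0 <= S n) ->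
  ((n.+1 ^ 2)%:R^-1 * S (n.+1 ^ 2)%N) @[n --> \oo] --> mu ->
  N%:R^-1 * S N @[N --> \oo] --> mu.
Proof.
move=> Smono S0 Ssq.
have : forall N, exists r, (N < r.+1 ^ 2)%N && (r ^ 2 <= N)%N.
  elim=> [|N [r /andP[Nr rN]]]; first by exists 0%N.
  have [e|e] := ltnP N.+1 (r.+1 ^ 2)%N; [exists r|exists r.+1]; lia.
move=> /choice[r rP].
have rlt N : (N < (r N).+1 ^ 2)%N by case/andP: (rP N).
have rle N : (r N ^ 2 <= N)%N by case/andP: (rP N).
(* The predecessor accounts for the hypothesis being indexed by n.+1. *)
have rinf : (r N).-1 @[N --> \oo] --> \oo.
  apply/cvgnyPge => A; near=> N.
  have NA : (A.+1 ^ 2 <= N)%N by near: N; exact: nbhs_infty_ge.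
  have := rlt N; nia.
have ratio : (n.+1%:R / n.+2%:R : R) @[n --> \oo] --> (1 : R).
  have -> : (fun n => n.+1%:R / n.+2%:R : R) =
      (fun n => 1 - (harmonic n.+1 : R)).
    apply/funext => n; rewrite /harmonic /=.
    by rewrite -[n.+2%:R]natr1; field; rewrite ?nat1r ?natr1 -?natrD ?pnatr_eq0.
  rewrite -[X in _ --> X]subr0; apply: cvgB; first exact: cvg_cst.
  by rewrite (@cvg_shiftS _ (harmonic : nat -> R)); exact: cvg_harmonic.
have rat0 n : (n.+1%:R / n.+2%:R : R) != 0 by rewrite mulf_neq0 ?invr_eq0 ?pnatr_eq0.
pose u n : R := (n.+1 ^ 2)%:R^-1 * S (n.+1 ^ 2)%N.
have lo : ((n.+1%:R / n.+2%:R) ^+ 2 * u n) @[n --> \oo] --> mu.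
  rewrite -[X in _ --> X]mul1r; apply: cvgM => //.
  by rewrite -[X in _ --> X](mulr1 1); apply: cvgM.
have ratioV : ((n.+1%:R / n.+2%:R)^-1 : R) @[n --> \oo] --> (1 : R).
  by rewrite -[X in _ --> X]invr1; apply: cvgV => //; exact: oner_neq0.
have hi : ((n.+1%:R / n.+2%:R)^-1 ^+ 2 * u n.+1) @[n --> \oo] --> mu.
  rewrite -[X in _ --> X]mul1r; apply: cvgM; last by rewrite (@cvg_shiftS _ u).
  by rewrite -[X in _ --> X](mulr1 1); apply: cvgM.
apply: (squeeze_cvgr _ (cvg_comp _ _ rinf lo) (cvg_comp _ _ rinf hi)).
near=> N => /=.
have N1 : (1 <= N)%N by near: N; exact: nbhs_infty_ge.
have [q rq] : exists q, r N = q.+1 by exists (r N).-1; have := rlt N; nia.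
have := rlt N; have := rle N; rewrite rq /= => qN Nq.
have ratio_mul (a b z : R) : a != 0 -> b != 0 ->
    (a / b) ^+ 2 * ((a ^+ 2)^-1 * z) = (b ^+ 2)^-1 * z.
  by move=> a0 b0; field; rewrite a0 b0.
have Npos : (0 : R) < N%:R by rewrite ltr0n.
apply/andP; split.
  have -> : (q.+1%:R / q.+2%:R) ^+ 2 * u q = (q.+2 ^ 2)%:R^-1 * S (q.+1 ^ 2)%N.
    by rewrite /u !natrX ratio_mul ?pnatr_eq0.
  by apply: ler_pM => //; [rewrite lef_pV2 ?posrE ?ltr0n // ler_nat ltnW|exact: Smono].
have -> : (q.+1%:R / q.+2%:R)^-1 ^+ 2 * u q.+1 = (q.+1 ^ 2)%:R^-1 * S (q.+2 ^ 2)%N.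
  by rewrite /u !natrX invf_div ratio_mul ?pnatr_eq0.
apply: ler_pM => //.
  by rewrite lef_pV2 ?posrE ?ltr0n // ler_nat.
by apply: Smono; rewrite ltnW.
Unshelve. all: by end_near.
Qed.

Lemma sum_inv_squares_le (n : nat) :
  \sum_(k < n) (k.+1%:R ^+ 2)^-1 <= (2 : R).
Proof.
case: n => [|n]; first by rewrite big_ord0.
(* Telescoping: 1/(k+1)^2 <= 1/k - 1/(k+1) for k >= 1. *)
suff: \sum_(k < n.+1) (k.+1%:R ^+ 2)^-1 <= (2 : R) - n.+1%:R^-1.
  by move=> /le_trans; apply; rewrite gerBl invr_ge0.
elim: n => [|n IH]; first by rewrite big_ord1 expr1n invr1; lra.
rewrite big_ord_recr /=; apply: le_trans (lerD IH (lexx _)) _.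
have n0 : (0 : R) < n.+1%:R by rewrite ltr0n.
have -> : n.+2%:R = n.+1%:R + 1 :> R by rewrite natr1.
move: (n.+1%:R) n0 => x x0.
have x1 : 0 < x + 1 by lra.
rewrite -subr_ge0.
have -> : 2 - (x + 1)^-1 - (2 - x^-1 + ((x + 1) ^+ 2)^-1) =
    (x * (x + 1) ^+ 2)^-1 by field; rewrite !gt_eqF.
by rewrite invr_ge0 mulr_ge0 ?sqr_ge0 // ltW.
Qed.
End MeanSquares.

Section StrongLaw.
Context {R : realType} {d : measure_display} {Omega : measurableType d}.
Context (P : probability Omega R).
Local Open Scope ereal_scope.

Section MeanSquareDeviation.
Variables (Y : nat -> Omega -> R) (mu C : R).
Hypothesis mY : forall k, measurable_fun setT (Y k).
Hypothesis Y0 : forall k w, (0 <= Y k w)%R.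
Hypothesis Ymean : forall k, \int[P]_w (Y k w)%:E = mu%:E.
Hypothesis Ysq : forall k, \int[P]_w (Y k w ^+ 2)%:E <= C%:E.
Hypothesis Ycov :
  forall k l, k != l -> \int[P]_w (Y k w * Y l w)%:E <= (mu ^+ 2)%:E.

(** Expanding the square, the N diagonal terms are at most C and the
    off-diagonal ones at most mu^2, so that subtracting (N mu)^2 leaves at most
    N C. *)
Lemma mean_square_deviation (N : nat) :
  \int[P]_w ((\sum_(k < N) Y k w - N%:R * mu) ^+ 2)%:E <= (N%:R * C)%:E.
Proof.
have mu0 : (0 <= mu)%R.
  by rewrite -lee_fin -(Ymean 0); apply: integral_ge0 => w _; rewrite lee_fin.
set S := fun w => (\sum_(k < N) Y k w)%R.
have mS : measurable_fun setT S by exact: measurable_sum.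
have S0 w : (0 <= S w)%R by apply: sumr_ge0.
set a := (N%:R * mu)%R.
have a0 : (0 <= a)%R by rewrite mulr_ge0.
have I1 : \int[P]_w (S w)%:E = a%:E.
  under eq_integral do rewrite -sumEFin.
  rewrite ge0_integral_sum //=; last first.
  - by move=> k w _; rewrite lee_fin.
  - by move=> k; exact/measurable_EFinP.
  under eq_bigr do rewrite Ymean.
  by rewrite sumEFin big_const_ord iter_addr_0 /a mulr_natl.
have I2 : \int[P]_w (S w ^+ 2)%:E <= (N%:R * C + a ^+ 2)%:E.
  have -> : \int[P]_w (S w ^+ 2)%:E =
      \sum_(k < N) \sum_(l < N) \int[P]_w (Y k w * Y l w)%:E.
    have e w : (S w ^+ 2)%:E = \sum_(k < N) \sum_(l < N) (Y k w * Y l w)%:E.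
      by rewrite expr2 /S mulr_suml -sumEFin; apply: eq_bigr => k _;
         rewrite mulr_sumr sumEFin.
    under eq_integral do rewrite e.
    have mkl k l : measurable_fun setT (fun w => (Y k w * Y l w)%:E).
      by apply/measurable_EFinP; exact: measurable_funM.
    rewrite ge0_integral_sum //=; last first.
    - by move=> k w _; apply: sume_ge0 => l _; rewrite lee_fin mulr_ge0.
    - by move=> k; exact: emeasurable_sum.
    apply: eq_bigr => k _; rewrite ge0_integral_sum //= => l w _.
    by rewrite lee_fin mulr_ge0.
  have -> : (N%:R * C + a ^+ 2)%:E =
      \sum_(k < N) \sum_(l < N) ((k == l)%:R * C + mu ^+ 2)%:E.
    under eq_bigr => k _.
      rewrite sumEFin big_split /= -mulr_suml (bigD1 k) //= eqxx big1; last first.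
        by move=> l /negbTE; rewrite eq_sym => ->.
      rewrite addr0 mul1r big_const_ord iter_addr_0; over.
    rewrite sumEFin big_const_ord iter_addr_0 /a -[in RHS]mulr_natl.
    by rewrite -mulr_natl; congr EFin; ring.
  apply: lee_sum => k _; apply: lee_sum => l _.
  have [<-|kl] := eqVneq k l; last by rewrite mul0r add0r; exact: Ycov.
  rewrite mul1r; apply: (@le_trans _ _ C%:E); first by exact: Ysq.
  by rewrite lee_fin lerDl sqr_ge0.
(* With a S on the left rather than subtracted on the right, all the functions
   are nonnegative and their integrals add up. *)
have I3 : \int[P]_w ((S w - a) ^+ 2)%:E + (2 * a * a)%:E =
    \int[P]_w (S w ^+ 2)%:E + (a ^+ 2)%:E.
  have mD : measurable_fun setT (fun w => (S w - a) ^+ 2)%R.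
    by apply: measurable_funX; apply: measurable_funB.
  rewrite EFinM -I1 -ge0_integralZl//=; last 3 first.
  - exact/measurable_EFinP.
  - by move=> w _; rewrite lee_fin.
  - by rewrite lee_fin mulr_ge0.
  rewrite -ge0_integralD//=; last 4 first.
  - by move=> w _; rewrite lee_fin sqr_ge0.
  - exact/measurable_EFinP.
  - by move=> w _; rewrite lee_fin !mulr_ge0.
  - by apply/measurable_EFinP; apply: measurable_funM.
  have -> : (a ^+ 2)%:E = \int[P]_w (cst (a ^+ 2)%:E w).
    by rewrite integral_cst //= probability_setT mule1.
  rewrite -ge0_integralD//=; last 3 first.
  - by move=> w _; rewrite lee_fin sqr_ge0.
  - by apply/measurable_EFinP; apply: measurable_funX.
  - by move=> w _; rewrite lee_fin sqr_ge0.
  by apply: eq_integral => w _; rewrite -!EFinD; congr EFin; ring.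
have : \int[P]_w ((S w - a) ^+ 2)%:E + (2 * a * a)%:E <=
    (N%:R * C)%:E + (2 * a * a)%:E.
  rewrite I3; apply: le_trans (leeD I2 (lexx _)) _.
  by rewrite -!EFinD lee_fin; lra.
by rewrite leeD2rE.
Qed.

End MeanSquareDeviation.

(** The mean square deviation of the mean of n^2 terms is at most C / n^2, which
    is summable; hence the sum over n of the squared deviations has finite
    integral, is finite almost surely, and its terms tend to 0.  Nonnegativity
    of the terms then fills the gaps between consecutive squares. *)
Lemma strong_law (Y : nat -> Omega -> R) (mu C : R)
    (mY : forall k, measurable_fun setT (Y k))
    (Y0 : forall k w, (0 <= Y k w)%R)
    (Ymean : forall k, \int[P]_w (Y k w)%:E = mu%:E)
    (Ysq : forall k, \int[P]_w (Y k w ^+ 2)%:E <= C%:E)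
    (Ycov : forall k l, k != l ->
      \int[P]_w (Y k w * Y l w)%:E <= (mu ^+ 2)%:E) :
  {ae P, forall w,
    (N%:R^-1 * \sum_(k < N) Y k w)%R @[N --> \oo] --> mu}.
Proof.
have C0 : (0 <= C)%R.
  rewrite -lee_fin; apply: le_trans (Ysq 0%N).
  by apply: integral_ge0 => w _; rewrite lee_fin sqr_ge0.
pose W n w : R :=
  (((n.+1 ^ 2)%:R^-1 * \sum_(k < n.+1 ^ 2) Y k w - mu) ^+ 2)%R.
have W0 n w : 0 <= (W n w)%:E by rewrite lee_fin sqr_ge0.
have mW n : measurable_fun setT (EFin \o W n).
  apply/measurable_EFinP; apply: measurable_funX; apply: measurable_funB => //.
  by apply: measurable_funM => //; exact: measurable_sum.
have IW n : \int[P]_w (W n w)%:E <= (C * (n.+1%:R ^+ 2)^-1)%:E.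
  pose c : R := ((n.+1 ^ 2)%:R^-1 ^+ 2)%R.
  have e w : (W n w)%:E = c%:E *
      ((\sum_(k < n.+1 ^ 2) Y k w - (n.+1 ^ 2)%:R * mu) ^+ 2)%:E.
    by rewrite -EFinM /c -exprMn mulrBr mulKf.
  under eq_integral do rewrite e.
  rewrite ge0_integralZl//=; last 3 first.
  - apply/measurable_EFinP; apply: measurable_funX; apply: measurable_funB => //.
    exact: measurable_sum.
  - by move=> w _; rewrite lee_fin sqr_ge0.
  - by rewrite lee_fin sqr_ge0.
  have c0 : 0 <= c%:E by rewrite lee_fin sqr_ge0.
  apply: le_trans (lee_wpmul2l c0
    (mean_square_deviation mY Y0 Ymean Ysq Ycov (n.+1 ^ 2))) _.
  rewrite -EFinM lee_fin /c natrX.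
  have : (n.+1%:R != 0 :> R)%R by rewrite pnatr_eq0.
  move: (n.+1%:R)%R => x x0; rewrite le_eqVlt; apply/orP; left; apply/eqP.
  by field.
have int : P.-integrable setT (fun w => \sum_(0 <= n <oo) (W n w)%:E).
  apply/integrableP; split; first exact: (@ge0_emeasurable_sum _ _ _ _
    (fun n w => (W n w)%:E) xpredT (fun k w _ _ => W0 k w) (fun k _ => mW k)).
  rewrite (eq_integral (fun w => \sum_(0 <= n <oo) (W n w)%:E)); last first.
    by move=> w _; rewrite gee0_abs//; apply: nneseries_ge0 => n _ _; exact: W0.
  rewrite integral_nneseries//.
  apply: (@le_lt_trans _ _ (C * 2)%:E); last by rewrite ltry.
  apply: lime_le.
    by apply: is_cvg_nneseries => n _ _; apply: integral_ge0 => w _; exact: W0.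
  apply: nearW => n; rewrite big_mkord.
  apply: (@le_trans _ _ (\sum_(k < n) (C * (k.+1%:R ^+ 2)^-1)%:E)).
    by apply: lee_sum => k _; exact: IW.
  rewrite sumEFin lee_fin -mulr_sumr ler_wpM2l//.
  exact: sum_inv_squares_le.
have := integrable_ae measurableT int.
apply: filterS => w /(_ I) fin.
apply: cvg_sandwich_squares.
- move=> m n mn; rewrite -(subnKC mn) big_split_ord /= lerDl.
  exact: sumr_ge0.
- by move=> n; exact: sumr_ge0.
have /cvg_series_cvg_0 W_0 : cvgn (series (fun n => W n w)).
  apply: nnseries_is_cvg; first by move=> i; rewrite sqr_ge0.
  by rewrite ltey_eq fin.
apply/subr_cvg0/norm_cvg0P.
have : Num.sqrt (W n w) @[n --> \oo] --> (0 : R)%R.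
  rewrite -[X in _ --> X](@sqrtr0 R).
  exact: (cvg_comp _ _ W_0 (@sqrt_continuous R 0%R)).
by rewrite (_ : (fun n => _) = (fun n => Num.sqrt (W n w)))//;
  apply/funext => n; rewrite /W sqrtr_sqr.
Qed.

End StrongLaw.

(** * Limits of sums of indicators *)

Section Limits.
Context {R : realType} {d : measure_display} {Omega : measurableType d}.
Context (P : probability Omega R).
Local Open Scope ereal_scope.

(** Fatou's lemma in the form of an upper bound on the integral of a pointwise
    limit by the limit of upper bounds. *)
Lemma fatou_le (f : nat -> Omega -> R) (g : Omega -> R) (c : nat -> \bar R)
    (l : \bar R) :
  (forall n, measurable_fun setT (f n)) -> (forall n w, (0 <= f n w)%R) ->
  (forall w, f n w @[n --> \oo] --> g w) ->
  (forall n, \int[P]_w (f n w)%:E <= c n) -> c @ \oo --> l ->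
  \int[P]_w (g w)%:E <= l.
Proof.
move=> mf f0 fg fc cl.
have -> : \int[P]_w (g w)%:E = \int[P]_w limn_einf (fun n => (f n w)%:E).
  apply: eq_integral => w _; apply/esym; apply: (cvg_limn_einf_sup _).1.
  by apply: cvg_EFin; [exact: nearW|exact: fg].
apply: le_trans (fatou _ _ _ _) _ => //.
- by move=> n; exact/measurable_EFinP.
- by move=> n w _; rewrite lee_fin.
rewrite -(cvg_limn_einf_sup cl).1.
rewrite !limn_einf_lim; apply: lee_lim; [exact: is_cvg_einfs..|].
apply: nearW => n; apply: le_ereal_inf_tmp => _ [m mn <-].
by apply: le_trans (fc m); apply: ereal_inf_lbound; exists m.
Qed.

(** A bound on the second moments is a form of uniform integrability: truncating
    at K costs at most C / K in mean, uniformly in n, because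
    y <= min(y, K) + y^2 / K; the truncated functions converge in mean by
    dominated convergence. *)
Lemma limit_of_means (f : nat -> Omega -> R) (g : Omega -> R) (mu C : R) :
  (forall n, measurable_fun setT (f n)) -> (forall n w, (0 <= f n w)%R) ->
  (forall w, f n w @[n --> \oo] --> g w) ->
  (forall n, \int[P]_w (f n w ^+ 2)%:E <= C%:E) ->
  \int[P]_w (f n w)%:E @[n --> \oo] --> mu%:E ->
  \int[P]_w (g w)%:E = mu%:E.
Proof.
move=> mf f0 fg fC fmu.
have g0 w : (0 <= g w)%R.
  rewrite -(cvg_lim (@Rhausdorff R) (fg w)); apply: limr_ge; last exact: nearW.
  by apply/cvg_ex; eexists; exact: fg.
have mg : measurable_fun setT g.
  by apply: (measurable_fun_cvg (h := f)) => // w _; exact: fg.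
apply/eqP; rewrite eq_le; apply/andP; split.
  exact: (fatou_le mf f0 fg _ fmu).
have mminf K n : measurable_fun setT (fun w => Num.min (f n w) K).
  exact: measurable_minr.
have step (K : R) : (0 < K)%R -> mu%:E <= \int[P]_w (g w)%:E + (C / K)%:E.
  move=> K0.
  have bnd n : \int[P]_w (f n w)%:E <=
      \int[P]_w (Num.min (f n w) K)%:E + (C / K)%:E.
    have h0 w : 0 <= (f n w ^+ 2 / K)%:E.
      by rewrite lee_fin mulr_ge0 ?sqr_ge0 // invr_ge0 ltW.
    have m0 w : 0 <= (Num.min (f n w) K)%:E by rewrite lee_fin le_min f0 ltW.
    have mh : measurable_fun setT (fun w => (f n w ^+ 2 / K)%:E).
      apply/measurable_EFinP; apply: measurable_funM => //.
      exact: measurable_funX.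
    have mm : measurable_fun setT (fun w => (Num.min (f n w) K)%:E).
      exact/measurable_EFinP.
    apply: (@le_trans _ _ (\int[P]_w ((Num.min (f n w) K)%:E +
                                     (f n w ^+ 2 / K)%:E))).
      apply: ge0_le_integral => //.
      - by move=> w _; rewrite lee_fin.
      - exact/measurable_EFinP.
      - exact: emeasurable_funD.
      move=> w _; rewrite -EFinD lee_fin.
      have [fK|Kf] := leP (f n w) K; first by rewrite lerDl -lee_fin.
      rewrite -[leLHS]add0r lerD ?(ltW K0)// ler_pdivlMr // expr2.
      by rewrite ler_wpM2l // ltW.
    rewrite ge0_integralD//; apply: leeD => //.
    under eq_integral do rewrite mulrC EFinM.
    rewrite ge0_integralZl//=; last 3 first.
    - by apply/measurable_EFinP; exact: measurable_funX.
    - by move=> w _; rewrite lee_fin sqr_ge0.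
    - by rewrite lee_fin invr_ge0 ltW.
    rewrite [in leRHS]mulrC EFinM; apply: lee_wpmul2l => //.
    by rewrite lee_fin invr_ge0 ltW.
  have cvg_minK w :
      (Num.min (f n w) K @[n --> \oo] --> Num.min (g w) K)%R.
    rewrite (_ : (fun n => Num.min (f n w) K) =
      (fun n => (f n w + K - `|f n w - K|) / 2)%R); last first.
      by apply/funext => n; rewrite minr_absE.
    rewrite minr_absE; apply: cvgMr_tmp; apply: cvgB.
      by apply: cvgD; [exact: fg|exact: cvg_cst].
    by apply: cvg_norm; apply: cvgB; [exact: fg|exact: cvg_cst].
  have lim : \int[P]_w (Num.min (f n w) K)%:E @[n --> \oo] -->
      \int[P]_w (Num.min (g w) K)%:E.
    apply: (@dominated_cvg _ _ _ P setT measurableT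
      (fun n w => (Num.min (f n w) K)%:E)
      (fun w => (Num.min (g w) K)%:E) (cst K%:E)) => //.
    - by move=> n; exact/measurable_EFinP.
    - move=> w _; apply: cvg_EFin; first exact: nearW.
      exact: cvg_minK.
    - exact: finite_measure_integrable_cst.
    - move=> n w _; rewrite gee0_abs ?lee_fin ?ge_min ?lexx ?orbT//.
      by rewrite le_min f0 ltW.
  have lim' : \int[P]_w (Num.min (f n w) K)%:E + (C / K)%:E @[n --> \oo] -->
      \int[P]_w (Num.min (g w) K)%:E + (C / K)%:E.
    by apply: cvgeD => //; [rewrite fin_num_adde_defl|exact: cvg_cst].
  apply: (@le_trans _ _ (\int[P]_w (Num.min (g w) K)%:E + (C / K)%:E)).
    rewrite -(cvg_lim _ fmu)// -(cvg_lim _ lim')//.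
    apply: lee_lim; [by apply/cvg_ex; eexists; exact: fmu|
      by apply/cvg_ex; eexists; exact: lim'|exact: nearW].
  apply: leeD => //; apply: ge0_le_integral => //.
  - by move=> w _; rewrite lee_fin le_min g0 ltW.
  - by apply/measurable_EFinP; exact: measurable_minr.
  - exact/measurable_EFinP.
  - by move=> w _; rewrite lee_fin ge_min lexx.
have C0 : (0 <= C)%R.
  rewrite -lee_fin; apply: le_trans (fC 0%N).
  by apply: integral_ge0 => w _; rewrite lee_fin sqr_ge0.
apply/lee_addgt0Pr => e e0.
(* With this K the truncation error C / K is below e; C + 1 covers C = 0. *)
have K0 : (0 < (C + 1) / e)%R by rewrite divr_gt0 // ltr_wpDl.
apply: le_trans (step _ K0) _; apply: leeD => //.
rewrite lee_fin invf_div mulrA ler_pdivrMr ?ltr_wpDl // mulrC.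
by rewrite ler_pM2l // lerDl.
Qed.

(** The copies are indexed by k, the steps of the approximation by n, and the
    indicators summed at step n by l < K n.  The probability of A k n l does not
    depend on k: this is all the identity in law of the copies that is used. *)
Section GridCounts.
Variables (A : nat -> nat -> nat -> set Omega) (c : nat -> R) (K : nat -> nat).
Variables (a : nat -> nat -> R).
Hypothesis mA : forall k n l, measurable (A k n l).
Hypothesis c0 : forall n, (0 <= c n)%R.
Hypothesis PA : forall k n l, (l < K n)%N -> P (A k n l) = (a n l)%:E.

Let count k n w : R := (c n * \sum_(l < K n) \1_(A k n l) w)%R.

Let mcount k n : measurable_fun setT (count k n).
Proof.
apply: measurable_funM => //; apply: measurable_sum => l.
exact: measurable_indic.
Qed.

Let count0 k n w : (0 <= count k n w)%R.
Proof. by rewrite mulr_ge0 // sumr_ge0. Qed.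

Lemma integral_count k n :
  \int[P]_w (count k n w)%:E = (c n * \sum_(l < K n) a n l)%:E.
Proof.
under eq_integral do rewrite EFinM.
rewrite ge0_integralZl//=; last 3 first.
- apply/measurable_EFinP; apply: measurable_sum => l; exact: measurable_indic.
- by move=> w _; rewrite lee_fin sumr_ge0.
- by rewrite lee_fin.
rewrite EFinM; congr (_ * _).
under eq_integral do rewrite -sumEFin.
rewrite ge0_integral_sum//=.
- rewrite -sumEFin; apply: eq_bigr => l _.
  by rewrite integral_indic// setIT; exact: PA.
- by move=> l; apply/measurable_EFinP; exact: measurable_indic.
Qed.

Lemma integral_count_mul k k' n :
  \int[P]_w (count k n w * count k' n w)%:E =
  (c n ^+ 2)%:E *
  \sum_(l < K n) \sum_(l' < K n) P (A k n l `&` A k' n l').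
Proof.
pose F l l' w : R := \1_(A k n l `&` A k' n l') w.
have F0 l l' w : 0 <= (F l l' w)%:E by rewrite lee_fin.
have mF l l' : measurable_fun setT (EFin \o F l l').
  by apply/measurable_EFinP; apply: measurable_indic; exact: measurableI.
have e w : (count k n w * count k' n w)%:E =
    (c n ^+ 2)%:E * \sum_(l < K n) \sum_(l' < K n) (F l l' w)%:E.
  under eq_bigr do rewrite sumEFin.
  rewrite sumEFin -EFinM; congr EFin.
  rewrite /count mulrACA -expr2 mulr_suml; congr (_ * _)%R.
  apply: eq_bigr => l _; rewrite mulr_sumr; apply: eq_bigr => l' _.
  by rewrite /F indicI.
under eq_integral do rewrite e.
rewrite ge0_integralZl//=; last 3 first.
- apply: emeasurable_sum => l; apply: emeasurable_sum => l'; exact: mF.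
- by move=> w _; apply: sume_ge0 => l _; apply: sume_ge0 => l' _; exact: F0.
- by rewrite lee_fin sqr_ge0.
congr (_ * _); rewrite ge0_integral_sum//=; last 2 first.
- by move=> l; apply: emeasurable_sum => l'; exact: mF.
- by move=> l w _; apply: sume_ge0 => l' _; exact: F0.
apply: eq_bigr => l _; rewrite ge0_integral_sum//=; last first.
  by move=> l'; exact: mF.
apply: eq_bigr => l' _; rewrite integral_indic ?setIT//.
exact: measurableI.
Qed.

Variables (Y : nat -> Omega -> R) (mu C : R).
Hypothesis countY : forall k w, count k n w @[n --> \oo] --> Y k w.
Hypothesis mean_count : (c n * \sum_(l < K n) a n l)%R @[n --> \oo] --> mu.
Hypothesis sq_count : forall k n,
  (c n ^+ 2)%:E * \sum_(l < K n) \sum_(l' < K n) P (A k n l `&` A k n l') <=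
  C%:E.
Hypothesis indA : forall k k' n l l', k != k' ->
  P (A k n l `&` A k' n l') = P (A k n l) * P (A k' n l').

Lemma limit_count_mean k : \int[P]_w (Y k w)%:E = mu%:E.
Proof.
apply: (limit_of_means (f := count k) (C := C)) => //.
  move=> n; under eq_integral do rewrite expr2.
  by rewrite integral_count_mul sq_count.
under eq_fun do rewrite integral_count.
by apply: cvg_EFin; [exact: nearW|exact: mean_count].
Qed.

(** Fatou's lemma gives E[Y_k Y_k'] <= mu^2 from the independence of the
    approximating sums, and this one-sided bound is what the strong law
    asks for. *)
Lemma strong_law_limit_count :
  {ae P, forall w, (N%:R^-1 * \sum_(k < N) Y k w)%R @[N --> \oo] --> mu}.
Proof.
apply: (strong_law (C := C)).
- move=> k; apply: (measurable_fun_cvg (h := count k)) => // w _; exact: countY.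
- move=> k w; rewrite -(cvg_lim (@Rhausdorff R) (@countY k w)).
  apply: limr_ge; last exact: nearW.
  by apply/cvg_ex; eexists; exact: countY.
- exact: limit_count_mean.
- move=> k; apply: (fatou_le (f := fun n w => (count k n w ^+ 2)%R)
    (c := fun=> C%:E)).
  + by move=> n; exact: measurable_funX.
  + by move=> n w; exact: sqr_ge0.
  + by move=> w; apply: cvgM; exact: countY.
  + move=> n; under eq_integral do rewrite expr2.
    by rewrite integral_count_mul sq_count.
  + exact: cvg_cst.
- move=> k k' kk'.
  apply: (fatou_le (f := fun n w => (count k n w * count k' n w)%R)
    (c := fun n => ((c n * \sum_(l < K n) a n l) ^+ 2)%:E)).
  + by move=> n; exact: measurable_funM.
  + by move=> n w; exact: mulr_ge0.
  + by move=> w; apply: cvgM; exact: countY.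
  + move=> n; rewrite integral_count_mul exprMn [in leRHS]EFinM; apply: lee_wpmul2l.
      by rewrite lee_fin sqr_ge0.
    rewrite expr2 mulr_suml -sumEFin; apply: lee_sum => l _.
    rewrite mulr_sumr -sumEFin; apply: lee_sum => l' _.
    by rewrite indA// !PA.
  + by apply: cvg_EFin; [exact: nearW|apply: cvgM; exact: mean_count].
Qed.

End GridCounts.
End Limits.

(** * Jump paths on a grid *)

Section JumpPaths.
Context {R : realType} {p : nat}.
Implicit Types (x : R -> 'I_p) (T : R).

Lemma near_rightP (t : R) (Q : set R) :
  (\forall u \near t^'+, Q u) <->
  exists2 e : R, 0 < e & forall u, t < u < t + e -> Q u.
Proof.
split=> [/nbhs_ballP[e /= e0 he]|[e e0 he]].
  exists e => // u /andP[tu ute]; apply: he => //=.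
  by rewrite /ball /= ltr_norml; lra.
near=> u; apply: he; apply/andP; split; near: u.
  exact: nbhs_right_gt.
by apply: nbhs_right_lt; rewrite ltrDl.
Unshelve. all: by end_near.
Qed.

Lemma near_leftP (t : R) (Q : set R) :
  (\forall u \near t^'-, Q u) <->
  exists2 e : R, 0 < e & forall u, t - e < u < t -> Q u.
Proof.
split=> [/nbhs_ballP[e /= e0 he]|[e e0 he]].
  exists e => // u /andP[tu ute]; apply: he => //=.
  by rewrite /ball /= ltr_norml; lra.
near=> u; apply: he; apply/andP; split; near: u.
  by apply: nbhs_left_gt; rewrite gtrBl.
exact: nbhs_left_lt.
Unshelve. all: by end_near.
Qed.

(** When x u = x v, the path is constant on [u, v] and tau is any time of ]u, v];
    otherwise tau is the jump time. *)
Definition single_jump x (u v tau : R) : Prop :=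
  [/\ u < tau <= v, forall r, u <= r < tau -> x r = x u &
      forall r, tau <= r <= v -> x r = x v].

(** A Lebesgue number argument: around each t of the compact interval [0, T] the
    path is constant on a left and on a right neighbourhood, and a short interval
    lies in one such neighbourhood of some t, its only possible jump being at
    t. *)
Lemma jump_path_single_jump x T : jump_path x ->
  exists2 e : R, 0 < e & forall u v, 0 <= u <= T -> u < v < u + e ->
    exists tau, single_jump x u v tau.
Proof.
move=> [xr xl].
pose good (e u : R) := 0 <= u -> forall v, u < v < u + e ->
  exists tau, single_jump x u v tau.
have cov : near_covering `[0, T] by apply/compact_near_coveringP; exact: segment_compact.
suff : \forall e \near (0 : R)^'+, `[0, T] `<=` good e.
  move=> h; have [e [e0 he]] : exists e : R, 0 < e /\ `[0, T] `<=` good e.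
    near (0 : R)^'+ => e; exists e; split; first by [].
    by near: e.
  exists e => // u v uT uv; apply: he uv => //.
  by case/andP: uT.
apply: cov => t; rewrite /= in_itv /= => /andP[t0 tT].
have [e1 e10 right] : exists2 e : R, 0 < e & forall r, t <= r < t + e -> x r = x t.
  have /near_rightP[e e0 he] := xr _ t0.
  exists e => // r /andP[]; rewrite le_eqVlt => /predU1P[<-//|tr re].
  by apply: he; rewrite tr.
have [e2 e20 [i left]] : exists2 e : R, 0 < e &
    exists i, forall r, 0 <= r -> t - e < r < t -> x r = i.
  (* At t = 0 there is no time r in the range, and any state will do. *)
  have [tp|] := ltP 0 t; last first.
    move=> tn; exists 1 => //; exists (x 0) => r r0 /andP[_ /lt_le_trans/(_ tn)].
    by rewrite ltNge r0.
  have [i /near_leftP[e e0 he]] := xl _ tp.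
  by exists e => //; exists i => r _ /he.
pose e := Num.min e1 e2 / 2.
have e0 : 0 < e by rewrite divr_gt0 // lt_min e10.
have ee1 : e + e <= e1 by rewrite -splitr ge_min lexx.
have ee2 : e + e <= e2 by rewrite -splitr ge_min lexx orbT.
near=> u b => /= u0 v /andP[uv vb].
have be : b < e by near: b; exact: nbhs_right_lt.
have ut : `|t - u| < e by near: u; exact: cvgr_dist_lt.
move: ut; rewrite ltr_norml => /andP[tu1 tu2].
have [tu|ut] := leP t u.
  exists v; split; first by rewrite uv lexx.
    move=> r /andP[ur rv]; rewrite !right //; lra.
  by move=> r /le_anti ->.
have left' r : u <= r < t -> x r = i by move=> /andP[ur rt]; apply: left; lra.
have [tv|vt] := leP t v.
  exists t; split; first by rewrite ut.
    move=> r /andP[ur rt]; rewrite !left' ?lexx //; lra.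
  move=> r /andP[tr rv]; rewrite !right //; lra.
exists v; split; first by rewrite uv lexx.
  move=> r /andP[ur rv]; rewrite !left' ?lexx //; lra.
by move=> r /le_anti ->.
Unshelve. all: by end_near.
Qed.

Definition grid T (n l : nat) : R := l%:R * (T / n.+1%:R).

Lemma grid0 T n : grid T n 0 = 0. Proof. by rewrite /grid mul0r. Qed.

Lemma grid_last T n : grid T n n.+1 = T.
Proof. by rewrite /grid mulrC divfK // pnatr_eq0. Qed.

Lemma gridS T n l : grid T n l.+1 = grid T n l + T / n.+1%:R.
Proof. by rewrite /grid -natr1 mulrDl mul1r. Qed.

Lemma grid_le T n l l' : 0 < T -> (grid T n l <= grid T n l') = (l <= l')%N.
Proof. by move=> T0; rewrite /grid ler_pM2r ?divr_gt0 // ler_nat. Qed.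

Lemma grid_lt T n l l' : 0 < T -> (grid T n l < grid T n l') = (l < l')%N.
Proof. by move=> T0; rewrite /grid ltr_pM2r ?divr_gt0 // ltr_nat. Qed.

Lemma grid_ge0 T n l : 0 < T -> 0 <= grid T n l.
Proof. by move=> T0; rewrite -(grid0 T n) grid_le. Qed.

Lemma grid_cell_oc T n t : 0 < T -> 0 < t <= T ->
  exists l : 'I_n.+1, grid T n l < t <= grid T n l.+1.
Proof.
move=> T0 /andP[t0 tT].
have ex : exists l, t <= grid T n l.+1 by exists n; rewrite grid_last.
case: (ex_minnP ex) => l tl lmin.
have ln : (l < n.+1)%N by rewrite ltnS lmin // grid_last.
exists (Ordinal ln); rewrite /= tl andbT ltNge; apply/negP.
case: l {tl ln} lmin => [|l] lmin tl; first by move: tl; rewrite grid0 leNgt t0.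
by have := lmin _ tl; rewrite ltnn.
Qed.

Lemma grid_cell_co T n t : 0 < T -> 0 <= t < T ->
  exists l : 'I_n.+1, grid T n l <= t < grid T n l.+1.
Proof.
move=> T0 /andP[t0 tT].
have ex : exists l, t < grid T n l.+1 by exists n; rewrite grid_last.
case: (ex_minnP ex) => l tl lmin.
have ln : (l < n.+1)%N by rewrite ltnS lmin // grid_last.
exists (Ordinal ln); rewrite /= tl andbT leNgt; apply/negP.
case: l {tl ln} lmin => [|l] lmin tl; first by move: tl; rewrite grid0 ltNge t0.
by have := lmin _ tl; rewrite ltnn.
Qed.

Lemma mesh_cvg0 T : T / n.+1%:R @[n --> \oo] --> 0.
Proof.
rewrite -[X in _ --> X](mulr0 T); apply: cvgM; first exact: cvg_cst.
exact: cvg_harmonic.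
Qed.

Definition grid_transitions x T n i j : nat :=
  (\sum_(l < n.+1) ((x (grid T n l) == i) && (x (grid T n l.+1) == j)))%N.

(** Below the length of jump_path_single_jump, a cell whose endpoints are in i and
    j holds exactly one jump, which goes from i to j; conversely each jump from i
    to j is the only one of its cell.  Thus tau is a bijection from the cells
    counted on the left onto the jump times. *)
Lemma transitions_grid x T (i j : 'I_p) : 0 < T -> jump_path x -> j != i ->
  \forall n \near \oo, grid_transitions x T n i j = transitions x T i j.
Proof.
move=> T0 xj ji; have [e e0 sj] := jump_path_single_jump T xj.
near=> n.
have he : T / n.+1%:R < e.
  near: n.
  exact: (cvgr_lt _ (mesh_cvg0 T) _ e0).
have /choice[tau tauP] : forall l : 'I_n.+1, exists tau,
    single_jump x (grid T n l) (grid T n l.+1) tau.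
  move=> l; apply: sj.
    by rewrite grid_ge0 // -[leRHS](grid_last T n) grid_le // ltnW.
  by rewrite grid_lt // ltnSn gridS ltrD2l.
pose D := [pred l : 'I_n.+1 |
  (x (grid T n l) == i) && (x (grid T n l.+1) == j)].
have jumpsE : jump_times x T i j = [set` [fset tau l | l in D]%fset].
  apply/seteqP; split=> t /=.
    move=> [t_gt0 tT left xt].
    have [l /andP[lt tl]] := grid_cell_oc n T0 (introT andP (conj t_gt0 tT)).
    have [/andP[ltau taul] before after] := tauP l.
    have [a a0 lefta] : exists2 a : R, 0 < a & forall u, t - a < u < t -> x u = i.
      exact/near_leftP.
    have tE : t = tau l.
      have [ttau|taut|//] := ltgtP t (tau l).
        (* The maximum is a time of the cell close enough to t on its left. *)
        have : x (Num.max (grid T n l) (t - a / 2)) = i.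
          by apply: lefta; rewrite lt_max gt_max lt; lra.
        rewrite before; last by rewrite le_max lexx /= gt_max ltau; lra.
        move=> xi; move: xt; rewrite before ?(ltW lt)//.
        by rewrite xi => /esym/eqP; rewrite (negbTE ji).
      have : x (Num.max (tau l) (t - a / 2)) = i.
        by apply: lefta; rewrite lt_max gt_max taut; lra.
      rewrite after; last by rewrite le_max lexx /= ge_max taul; lra.
      by rewrite -(after t) ?(ltW taut)// xt => /eqP; rewrite (negbTE ji).
    apply/imfsetP; exists l => //=; rewrite inE; apply/andP; split; apply/eqP.
      have : x (Num.max (grid T n l) (t - a / 2)) = i.
        by apply: lefta; rewrite lt_max gt_max lt; lra.
      by rewrite before // le_max lexx /= gt_max ltau -tE; lra.
    by rewrite -(after t) // tE lexx.
  move=> /imfsetP[l /=]; rewrite inE => /andP[/eqP xi /eqP xj'] ->.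
  have [/andP[ltau taul] before after] := tauP l.
  split.
  - by apply: le_lt_trans ltau; exact: grid_ge0.
  - by apply: le_trans taul _; rewrite -[leRHS](grid_last T n) grid_le.
  - apply/near_leftP; exists (tau l - grid T n l); first by rewrite subr_gt0.
    by move=> u /andP[lu ut]; rewrite before ?xi //; lra.
  - by rewrite after ?xj' ?lexx.
rewrite /transitions jumpsE set_fsetK card_in_imfset /=; last first.
  move=> l l' _ _ ll'.
  have [/andP[ltau taul] _ _] := tauP l.
  have [/andP[ltau' taul'] _ _] := tauP l'.
  apply/val_inj/eqP; rewrite eqn_leq -ltnS -[X in _ && X]ltnS.
  by rewrite -!(grid_lt n _ _ T0) (lt_le_trans ltau) ?ll' // (lt_le_trans ltau') // -ll'.
rewrite -cardE -sum1_card big_mkcond /=; apply: eq_bigr => l _.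
by rewrite inE; case: (_ && _).
Unshelve. all: by end_near.
Qed.

End JumpPaths.

(** * Occupation times as limits of Riemann sums *)

Section Occupation.
Context {R : realType} {p : nat}.
Implicit Types (x : R -> 'I_p) (T : R).

Let cell T n l : set R := `[grid T n l, grid T n l.+1[.

(** Each cell is sampled at its right endpoint, so that right-continuity gives
    convergence at every time, jump times included. *)
Let sample x T i n (u : R) : R :=
  \sum_(l < n.+1) (x (grid T n l.+1) == i)%:R * \1_(cell T n l) u.

Lemma sampleE x T i n (l : 'I_n.+1) u : 0 < T -> cell T n l u ->
  sample x T i n u = (x (grid T n l.+1) == i)%:R.
Proof.
move=> T0 lu; rewrite /sample (bigD1 l) //= indicE mem_set // mulr1.
rewrite big1 ?addr0 // => l' l'l; rewrite indicE memNset ?mulr0 //.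
move: lu; rewrite /cell /= !in_itv /= => /andP[lu ul] /andP[l'u ul'].
move/eqP: l'l; apply; apply/val_inj/eqP.
rewrite eqn_leq -ltnS -[X in _ && X]ltnS -!(grid_lt n _ _ T0).
by rewrite (le_lt_trans l'u) // (le_lt_trans lu).
Qed.

Lemma measurable_sample x T i n (D : set R) :
  measurable_fun D (sample x T i n).
Proof.
apply: measurable_sum => l; apply: measurable_funM => //.
by apply: measurable_indic; exact: measurable_itv.
Qed.

Lemma sample_cvg x T i u : 0 < T -> jump_path x -> 0 <= u < T ->
  sample x T i n u @[n --> \oo] --> ((x u == i)%:R : R).
Proof.
move=> T0 [xr _] /andP[u0 uT].
have /near_rightP[e e0 he] := xr _ u0.
apply: cvg_near_cst; near=> n.
have hn : T / n.+1%:R < e.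
  near: n.
  exact: (cvgr_lt _ (mesh_cvg0 T) _ e0).
have [l /andP[lu ul]] : exists l : 'I_n.+1, grid T n l <= u < grid T n l.+1.
  by apply: grid_cell_co; rewrite // u0.
rewrite (@sampleE _ _ _ _ l) //; last by rewrite /cell /= in_itv /= lu.
by rewrite he // ul gridS /= ler_ltD.
Unshelve. all: by end_near.
Qed.

(** Measurability in time is not part of the definition of a path; it is
    inherited from the step functions [sample]. *)
Lemma measurable_state x T i : 0 < T -> jump_path x ->
  measurable_fun `[0, T[ (fun u => (x u == i)%:R : R).
Proof.
move=> T0 xj; apply: (measurable_fun_cvg (h := sample x T i)).
  by move=> n; exact: measurable_sample.
by move=> u; rewrite /= in_itv /= => uT; exact: sample_cvg.
Qed.

(** The half-open interval [0, T[ is a union of grid cells. *)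
Lemma occupation_time_co x T i : 0 < T -> jump_path x ->
  occupation_time x T i =
  fine (\int[lebesgue_measure]_(u in `[0%R, T[) ((x u == i)%:R)%:E)%E.
Proof.
move=> T0 xj; rewrite /occupation_time /Rintegral integral_itv_bndo_bndc//.
by apply/measurable_EFinP; exact: measurable_state.
Qed.

Lemma lebesgue_co (a b : R) : a <= b ->
  lebesgue_measure (`[a, b[ : set R) = (b - a)%:E.
Proof.
rewrite le_eqVlt => /predU1P[->|ab].
  by rewrite lebesgue_measure_itv /= ltxx subrr.
by rewrite lebesgue_measure_itv /= lte_fin ab EFinB.
Qed.

Lemma integral_sample x T i n : 0 < T ->
  (\int[lebesgue_measure]_(u in `[0%R, T[) (sample x T i n u)%:E)%E =
  (T / n.+1%:R * \sum_(l < n.+1) (x (grid T n l.+1) == i)%:R)%:E.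
Proof.
move=> T0; under eq_integral do rewrite -sumEFin.
rewrite ge0_integral_sum//=; last first.
  move=> l; apply/measurable_EFinP; apply: measurable_funM => //.
  by apply: measurable_indic; exact: measurable_itv.
rewrite mulr_sumr -sumEFin; apply: eq_bigr => l _.
under eq_integral do rewrite EFinM.
rewrite ge0_integralZl//=; last first.
  by apply/measurable_EFinP; apply: measurable_indic; exact: measurable_itv.
rewrite integral_indic//=; last exact: measurable_itv.
rewrite (_ : cell T n l `&` _ = cell T n l); last first.
  apply: setIidl => u; rewrite /cell /= !in_itv /= => /andP[lu ul].
  rewrite (le_trans (grid_ge0 n l T0) lu) (lt_le_trans ul) //.
  by rewrite -[leRHS](grid_last T n) grid_le.
rewrite lebesgue_co; last by rewrite grid_le.
by rewrite gridS addrAC subrr add0r -EFinM mulrC.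
Qed.

Lemma occupation_grid x T i : 0 < T -> jump_path x ->
  T / n.+1%:R * \sum_(l < n.+1) (x (grid T n l.+1) == i)%:R @[n --> \oo] -->
  occupation_time x T i.
Proof.
move=> T0 xj; rewrite occupation_time_co//.
have le1 n u : 0 <= u < T -> (`|(sample x T i n u)%:E| <= 1)%E.
  move=> uT; have [l lu] := grid_cell_co n T0 uT.
  rewrite (@sampleE _ _ _ _ l) ?/cell /= ?in_itv// lee_fin.
  by case: (_ == _); rewrite ?normr0 ?normr1.
have lim : (\int[lebesgue_measure]_(u in `[0%R, T[) (sample x T i n u)%:E)%E
    @[n --> \oo] -->
    (\int[lebesgue_measure]_(u in `[0%R, T[) ((x u == i)%:R)%:E)%E.
  apply: (@dominated_cvg _ _ _ lebesgue_measure `[0%R, T[ _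
    (fun n u => (sample x T i n u)%:E) _ (cst 1%E)) => //.
  - by move=> n; apply/measurable_EFinP; exact: measurable_sample.
  - move=> u uT; have {}uT : 0 <= u < T by move: uT; rewrite /= in_itv.
    by apply: cvg_EFin; [exact: nearW|exact: sample_cvg].
  - apply/integrableP; split=> //.
    under eq_integral do rewrite abse1.
    rewrite integral_cst//= mul1e lebesgue_co ?ltW// ?subr0 ltry//.
have -> : (fun n => T / n.+1%:R * \sum_(l < n.+1) (x (grid T n l.+1) == i)%:R) =
    fine \o (fun n => \int[lebesgue_measure]_(u in `[0%R, T[) (sample x T i n u)%:E)%E.
  by apply/funext => n /=; rewrite integral_sample.
apply: fine_cvg; rewrite fineK //.
rewrite ge0_fin_numE; last by apply: integral_ge0 => u _; rewrite lee_fin.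
apply: (@le_lt_trans _ _ T%:E); last by rewrite ltry.
rewrite -(cvg_lim _ lim) //; apply: lime_le; first by apply/cvg_ex; eexists; exact: lim.
apply: nearW => n; rewrite integral_sample // lee_fin.
rewrite mulrAC ler_pdivrMr ?ltr0n // ler_pM2l //.
rewrite -natr_sum ler_nat -[leqRHS]card_ord -sum1_card.
by apply: leq_sum => l _; exact: leq_b1.
Qed.

Lemma occupation_time_gt0 x T i t : 0 < T -> jump_path x ->
  0 <= t < T -> x t = i -> 0 < occupation_time x T i.
Proof.
move=> T0 xj /andP[t0 tT] xt.
have [e e0 he] : exists2 e : R, 0 < e & forall u, t <= u < t + e -> x u = i.
  have /near_rightP[e e0 he] := xj.1 _ t0.
  exists e => // r /andP[]; rewrite le_eqVlt => /predU1P[<-//|tr re].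
  by rewrite -xt; apply: he; rewrite tr.
pose b := Num.min T (t + e).
have tb : t < b by rewrite lt_min tT ltrDl.
have le_ind : (\int[lebesgue_measure]_(u in `[0%R, T[) (\1_(`[t, b[ : set R) u)%:E <=
    \int[lebesgue_measure]_(u in `[0%R, T[) ((x u == i)%:R)%:E)%E.
  apply: ge0_le_integral => //.
  - by apply/measurable_EFinP; apply: measurable_indic; exact: measurable_itv.
  - by apply/measurable_EFinP; exact: measurable_state.
  - move=> u _; rewrite lee_fin indicE.
    have [|_] := boolP (u \in _); last by rewrite ler0n.
    rewrite inE /= in_itv /= lt_min => /andP[tu /andP[_ ue]].
    by rewrite he ?tu // eqxx.
have ind : (\int[lebesgue_measure]_(u in `[0%R, T[) (\1_(`[t, b[ : set R) u)%:E =
    (b - t)%:E)%E.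
  rewrite integral_indic//= (_ : _ `&` _ = `[t, b[%classic) ?lebesgue_co ?ltW//.
  apply: setIidl => u; rewrite /= !in_itv /= lt_min => /andP[tu /andP[uT _]].
  by rewrite uT (le_trans t0).
have fin : (\int[lebesgue_measure]_(u in `[0%R, T[) ((x u == i)%:R)%:E <= T%:E)%E.
  apply: (@le_trans _ _ (\int[lebesgue_measure]_(u in `[0%R, T[) (cst 1 u))%E).
    apply: ge0_le_integral => //.
    - by apply/measurable_EFinP; exact: measurable_state.
    - by move=> u _; rewrite lee_fin lern1 leq_b1.
  by rewrite integral_cst//= mul1e lebesgue_co ?(ltW T0)// subr0 lexx.
rewrite occupation_time_co//.
have bt : (0 < (b - t)%:E)%E by rewrite lte_fin subr_gt0.
apply: fine_gt0; rewrite (lt_le_trans bt) -?ind //=.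
by rewrite (le_lt_trans fin) ?ltry.
Qed.

End Occupation.

(** * The matrix exponential near the origin *)

Section MatrixExponential.
Context {R : realType} {p : nat}.
Implicit Types (A Q : 'M[R]_p).

(** A submultiplicative norm that dominates every entry. *)
Definition entry_sum A : R := \sum_a \sum_b `|A a b|.

Lemma entry_sum_ge0 A : 0 <= entry_sum A.
Proof. by apply: sumr_ge0 => a _; apply: sumr_ge0. Qed.

Lemma entry_sumZ (h : R) A : 0 <= h -> entry_sum (h *: A) = h * entry_sum A.
Proof.
move=> h0; rewrite /entry_sum mulr_sumr; apply: eq_bigr => a _.
by rewrite mulr_sumr; apply: eq_bigr => b _; rewrite mxE normrM ger0_norm.
Qed.

Lemma expr_entry_le A k a b : `|(A ^+ k) a b| <= entry_sum A ^+ k.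
Proof.
elim: k a b => [|k IH] a b.
  by rewrite expr0 expr0 mxE; case: (_ == _); rewrite ?normr0 ?normr1.
rewrite exprS mxE; apply: le_trans (ler_norm_sum _ _ _) _.
apply: (@le_trans _ _ (\sum_l `|A a l| * entry_sum A ^+ k)).
  by apply: ler_sum => l _; rewrite normrM ler_wpM2l.
rewrite -mulr_suml exprS ler_wpM2r ?exprn_ge0 ?entry_sum_ge0 //.
rewrite [leRHS](bigD1 a) //= lerDl.
by apply: sumr_ge0 => c _; apply: sumr_ge0.
Qed.

(** Off the diagonal the terms of order 0 and 1 of the series are 0 and A i j; the
    rest is dominated by the tail of exp(y) from order 2, and
    y^(k+2)/(k+2)! <= y^2 y^k/k!. *)
Lemma expmx_offdiag_le A i j : j != i ->
  `|expmx A i j - A i j| <= entry_sum A ^+ 2 * expR (entry_sum A).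
Proof.
move=> ji; rewrite mxE; set y := entry_sum A.
have y0 : 0 <= y by exact: entry_sum_ge0.
pose u k : R := (A ^+ k) i j / k`!%:R.
have ule k : `|u k| <= exp_coeff y k.
  rewrite /u /exp_coeff /= normrM normfV (ger0_norm (ler0n _ _)).
  by rewrite ler_wpM2r ?invr_ge0 // expr_entry_le.
have u0 : u 0%N = 0 by rewrite /u expr0 mxE eq_sym (negbTE ji) mul0r.
have u1 : u 1%N = A i j by rewrite /u expr1 factS fact0 muln1 divr1.
have cu : cvgn (series u).
  apply: normed_cvg; apply: series_le_cvg (is_cvg_series_exp_coeff y) => n.
  - exact: normr_ge0.
  - exact: le_trans (normr_ge0 _) (ule n).
  - exact: ule.
have cu2 : series u (n + 2)%N @[n --> \oo] --> limn (series u).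
  by rewrite cvg_shiftn.
have cn : `|series u (n + 2)%N - A i j| @[n --> \oo] -->
    `|limn (series u) - A i j|.
  by apply: cvg_norm; apply: cvgB => //; exact: cvg_cst.
rewrite -[leLHS](cvg_lim _ cn) //; apply: limr_le.
  by apply/cvg_ex; eexists; exact: cn.
apply: nearW => n.
have -> : series u (n + 2)%N - A i j = \sum_(0 <= k < n) u k.+2.
  rewrite /series /= addn2 big_nat_recl // big_nat_recl //= u0 u1 add0r.
  by rewrite addrAC subrr add0r.
apply: le_trans (ler_norm_sum _ _ _) _.
apply: (@le_trans _ _ (y ^+ 2 * series (exp_coeff y) n)).
  rewrite /series /= mulr_sumr; apply: ler_sum => k _.
  apply: le_trans (ule _) _; rewrite /exp_coeff /= -addn2 exprD -mulrA mulrCA.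
  rewrite mulrA [leRHS]mulrA ler_wpM2l ?mulr_ge0 ?exprn_ge0 //.
  rewrite lef_pV2 ?posrE ?ltr0n ?fact_gt0 // ler_nat addn2.
  by rewrite !factS; have := fact_gt0 k; nia.
rewrite ler_wpM2l ?sqr_ge0 // /expR.
apply: nondecreasing_cvgn_le; last exact: is_cvg_series_exp_coeff.
apply: nondecreasing_series => k _ _.
by rewrite /exp_coeff /= mulr_ge0 ?exprn_ge0 ?invr_ge0.
Qed.

Lemma expmx_rate Q (T : R) i j : 0 < T -> j != i ->
  n.+1%:R * expmx ((T / n.+1%:R) *: Q) i j @[n --> \oo] --> T * Q i j.
Proof.
move=> T0 ji; set c := entry_sum Q.
have c0 : 0 <= c by exact: entry_sum_ge0.
apply/subr_cvg0/norm_cvg0P.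
have b0 : T / n.+1%:R * (T * c ^+ 2 * expR (T * c)) @[n --> \oo] --> 0.
  by rewrite -[X in _ --> X](mul0r (T * c ^+ 2 * expR (T * c)));
    apply: cvgMr_tmp; exact: (@mesh_cvg0 R T).
apply: (squeeze_cvgr _ (cvg_cst 0) b0); apply: nearW => n.
rewrite normr_ge0 /=; set h := T / n.+1%:R.
have h0 : 0 <= h by rewrite divr_ge0 ?ltW.
have hn : h * n.+1%:R = T by rewrite divfK // pnatr_eq0.
have hT : h <= T by rewrite -hn ler_peMr // ler1n.
have -> : n.+1%:R * expmx (h *: Q) i j - T * Q i j =
    n.+1%:R * (expmx (h *: Q) i j - (h *: Q) i j).
  by rewrite -hn [(h *: Q) i j]mxE; ring.
rewrite normrM ger0_norm //.
apply: le_trans (ler_wpM2l _ (expmx_offdiag_le _ ji)) _ => //.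
rewrite entry_sumZ // -/c.
have -> : n.+1%:R * ((h * c) ^+ 2 * expR (h * c)) =
    h * ((h * n.+1%:R) * c ^+ 2 * expR (h * c)) by ring.
rewrite hn !ler_wpM2l ?mulr_ge0 ?sqr_ge0 ?(ltW T0) //.
by rewrite ler_expR ler_wpM2r.
Qed.

End MatrixExponential.

(** * Consequences of the Markov property *)

Section Partition.
Context {R : realType} {d : measure_display} {Omega : measurableType d}.
Context (P : probability Omega R).

Lemma probability_partition (V : finType) (v : Omega -> V) (C : pred V)
    (D : set Omega) :
  (forall c, measurable (D `&` [set w | v w = c])) ->
  P (D `&` [set w | C (v w)]) =
  (\sum_(c | C c) P (D `&` [set w | v w = c]))%E.
Proof.
move=> mD; rewrite (bigfs _ (index_enum_uniq V)); last first.
  by move=> c _; rewrite mem_index_enum.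
rewrite -measure_fin_bigcup //; last first.
- move=> c c' _ _ [w /= [[_ <-] [_ <-]]] //.
congr (P _); apply/seteqP; split=> w /=.
  by move=> [Dw Cw]; exists (v w) => //; rewrite /mkset; split.
by move=> [c Cc [Dw vc]]; split=> //; rewrite vc.
Qed.

End Partition.

Section ProcessLaws.
Context {R : realType} {d : measure_display} {Omega : measurableType d}.
Context {p M : nat} (P : probability Omega R).
Context (pi_ : 'I_p -> R) (s : 'I_p -> 'I_M -> R) (Q : 'I_M -> 'M[R]_p).
Context (X : R -> Omega -> 'I_p) (phi : Omega -> 'I_M).
Hypothesis hX : mixture_process P pi_ s Q X phi.
Local Open Scope ereal_scope.

Definition regime m : set Omega := [set w | phi w = m].
Definition state t i : set Omega := [set w | X t w = i].

Lemma measurable_regime m : measurable (regime m).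
Proof. exact: mixture_measurable_regime hX m. Qed.

Lemma measurable_state_event t i : (0 <= t)%R -> measurable (state t i).
Proof. exact: mixture_measurable_state hX t i. Qed.

(** Conditionally on the regime, an event b on the past up to t n influences the
    state at t n.+1 only through the state at t n.  The past takes finitely many
    values, so the event splits into cylinders, whose probabilities with and
    without the last state differ by the last factor of the product. *)
Lemma markov_step (m : 'I_M) (n : nat) (t : nat -> R)
    (b : pred {ffun 'I_n.+1 -> 'I_p}) (i j : 'I_p) :
  t 0%N = 0%R -> (forall l, (l < n.+1)%N -> (t l < t l.+1)%R) ->
  P (regime m `&` [set w | b [ffun k : 'I_n.+1 => X (t k) w]] `&`
     state (t n) i `&` state (t n.+1) j) =
  P (regime m `&` [set w | b [ffun k : 'I_n.+1 => X (t k) w]] `&`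
     state (t n) i) *
  (expmx ((t n.+1 - t n) *: Q m) i j)%:E.
Proof.
move=> t0 tS.
have tge l : (l <= n.+1)%N -> (0 <= t l)%R.
  elim: l => [|l IH] ln; first by rewrite t0.
  by apply: le_trans (IH (ltnW ln)) (ltW (tS _ ln)).
pose v w := [ffun k : 'I_n.+1 => X (t k) w].
have vE w c : v w = c <-> forall l, (l <= n)%N -> X (t l) w = c (inord l).
  split=> [<- l ln|h]; first by rewrite ffunE inordK.
  by apply/ffunP => k; rewrite ffunE h ?inord_val // -ltnS.
have mv (D : set Omega) c : measurable D -> measurable (D `&` [set w | v w = c]).
  move=> mD; apply: measurableI => //.
  rewrite (_ : mkset _ = \bigcap_(k in [set: 'I_n.+1]) state (t k) (c k)); last first.
    apply/seteqP; split=> w /=.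
      by move=> /vE h k _; rewrite /state /= h ?inord_val // -ltnS.
    by move=> h; apply/ffunP => k; rewrite ffunE; exact: h.
  apply: fin_bigcap_measurable => // k _.
  by apply: measurable_state_event; apply: tge; rewrite ltnW.
pose C c := b c && (c ord_max == i).
have lastE w : v w ord_max = X (t n) w by rewrite ffunE.
have setE : regime m `&` [set w | b (v w)] `&` state (t n) i =
    regime m `&` [set w | C (v w)].
  apply/seteqP; split=> w /=; rewrite /C lastE.
    by move=> [[rw bw] xw]; split=> //; rewrite bw -xw eqxx.
  by move=> [rw /andP[bw /eqP xw]].
rewrite -/v -/(v _) setE.
rewrite setIAC (@probability_partition _ _ _ P _ v); last first.
  move=> c; apply: mv; apply: measurableI; first exact: measurable_regime.
  by apply: measurable_state_event; exact: tge.
rewrite (@probability_partition _ _ _ P _ v); last first.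
  by move=> c; apply: mv; exact: measurable_regime.
rewrite ge0_sume_distrl //; apply: eq_bigr => c /andP[_ /eqP ci].
pose path l := if (l <= n)%N then c (inord l) else j.
have tS' l : (l < n)%N -> (t l < t l.+1)%R by move=> ln; exact/tS/ltnW.
have := @mixture_markov _ _ _ _ _ _ _ _ _ _ _ hX m n.+1 t path t0 tS.
have := @mixture_markov _ _ _ _ _ _ _ _ _ _ _ hX m n t path t0 tS'.
have -> : [set w | forall l, (l <= n)%N -> X (t l) w = path l] = [set w | v w = c].
  apply/seteqP; split=> w /=; rewrite vE => h l ln.
    by rewrite h // /path ln.
  by rewrite /path ln h.
have -> : [set w | forall l, (l <= n.+1)%N -> X (t l) w = path l] =
    state (t n.+1) j `&` [set w | v w = c].
  apply/seteqP; split=> w /=; rewrite vE.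
    move=> h; split; first by rewrite /state /= h // /path ltnn.
    by move=> l ln; rewrite h ?leqW // /path ln.
  move=> [wj h] l; rewrite leq_eqVlt => /predU1P[->|ln].
    by rewrite /path ltnn.
  by rewrite h // /path -ltnS ln.
rewrite setIA => -> ->.
rewrite big_ord_recr /= EFinM muleA; congr (_ * (expmx _ _ _)%:E).
  by rewrite /path leqnn -ci; congr (c _); apply/val_inj; rewrite /= inordK.
by rewrite /path ltnn.
Qed.

(** The right-hand side involves pi, s and Q alone, hence is common to all
    copies. *)
Lemma state_law m t i : (0 < t)%R ->
  P (regime m `&` state t i) =
  \sum_c ((s c m * pi_ c * expmx (t *: Q m) c i)%:E).
Proof.
move=> t0.
(* Conditioning on the initial state splits the event into two-point cylinders. *)
have -> : regime m `&` state t i =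
    (regime m `&` state t i) `&` [set w | predT (X 0%R w)].
  by apply/seteqP; split=> w //= [].
rewrite probability_partition; last first.
  move=> c; apply: measurableI; last exact: measurable_state_event.
  apply: measurableI; first exact: measurable_regime.
  by apply: measurable_state_event; exact: ltW.
apply: eq_bigr => c _.
pose tt l : R := if l is 0%N then 0%R else t.
pose path l := if l is 0%N then c else i.
have := @mixture_markov _ _ _ _ _ _ _ _ _ _ _ hX m 1%N tt path erefl.
have -> : [set w | forall l, (l <= 1)%N -> X (tt l) w = path l] =
    state t i `&` [set w | X 0%R w = c].
  apply/seteqP; split=> w /=.
    by move=> h; split; [exact: (h 1%N)|exact: (h 0%N)].
  by move=> [h1 h0] [|[|l]].
rewrite setIA => ->; last by move=> [|l].
rewrite big_ord1 /= subr0 EFinM; congr (_ * _).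
rewrite EFinM -(mixture_initial hX) -(mixture_regime hX); congr (P _).
by apply/seteqP; split=> w /= [].
Qed.

Lemma state_law0 m i : P (regime m `&` state 0 i) = (s i m * pi_ i)%:E.
Proof.
rewrite EFinM -(mixture_initial hX) -(mixture_regime hX); congr (P _).
by apply/seteqP; split=> w /= [].
Qed.

Lemma observed_regime m : observed_sigma X phi (regime m).
Proof. by apply: sub_sigma_algebra; right; exists m. Qed.

Lemma observed_state t i : (0 <= t)%R -> observed_sigma X phi (state t i).
Proof. by move=> t0; apply: sub_sigma_algebra; left; exists t, i. Qed.

Lemma observedI A B : observed_sigma X phi A -> observed_sigma X phi B ->
  observed_sigma X phi (A `&` B).
Proof. exact: (@measurableI _ (g_sigma_algebraType _)). Qed.

End ProcessLaws.

(** * Grid events of one process *)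

Section GridEvents.
Context {R : realType} {d : measure_display} {Omega : measurableType d}.
Context {p M : nat} (P : probability Omega R).
Context (pi_ : 'I_p -> R) (s : 'I_p -> 'I_M -> R) (Q : 'I_M -> 'M[R]_p).
Variable T : R.
Hypothesis T0 : 0 < T.
Implicit Types (X : R -> Omega -> 'I_p) (phi : Omega -> 'I_M).

Definition regime_state X phi m i t := regime phi m `&` state X t i.

Definition regime_jump X phi m i j n l :=
  regime_state X phi m i (grid T n l) `&` state X (grid T n l.+1) j.

Lemma in_regime phi m w : (w \in regime phi m) = (phi w == m).
Proof. by apply/idP/eqP; rewrite inE. Qed.

Lemma in_state X t i w : (w \in state X t i) = (X t w == i).
Proof. by apply/idP/eqP; rewrite inE. Qed.

Lemma indic_regime_state X phi m i t w :
  \1_(regime_state X phi m i t) w = (phi w == m)%:R * (X t w == i)%:R :> R.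
Proof.
by rewrite indicI /= !indicE in_regime in_state.
Qed.

Lemma indic_regime_jump X phi m i j n l w :
  \1_(regime_jump X phi m i j n l) w =
  (phi w == m)%:R *
  ((X (grid T n l) w == i) && (X (grid T n l.+1) w == j))%:R :> R.
Proof.
by rewrite indicI /= indic_regime_state -mulrA indicE in_state -mulnb natrM.
Qed.

Section OneProcess.
Variables (X : R -> Omega -> 'I_p) (phi : Omega -> 'I_M).
Hypothesis hX : mixture_process P pi_ s Q X phi.

Lemma observed_regime_state m i t : 0 <= t ->
  observed_sigma X phi (regime_state X phi m i t).
Proof.
by move=> t0; apply: observedI; [exact: observed_regime|exact: observed_state].
Qed.

Lemma observed_regime_jump m i j n l :
  observed_sigma X phi (regime_jump X phi m i j n l).
Proof.
apply: observedI; first by apply: observed_regime_state; exact: grid_ge0.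
by apply: observed_state; exact: grid_ge0.
Qed.

Lemma measurable_regime_state m i t : 0 <= t ->
  measurable (regime_state X phi m i t).
Proof.
move=> t0; apply: measurableI; first exact: measurable_regime hX m.
exact: measurable_state_event hX t i t0.
Qed.

Lemma measurable_regime_jump m i j n l :
  measurable (regime_jump X phi m i j n l).
Proof.
apply: measurableI; first by apply: measurable_regime_state; exact: grid_ge0.
by apply: (measurable_state_event hX); exact: grid_ge0.
Qed.

Definition regime_state_prob m i t : R := fine (P (regime_state X phi m i t)).

Lemma regime_state_probE m i t : 0 <= t ->
  P (regime_state X phi m i t) = (regime_state_prob m i t)%:E.
Proof.
move=> t0; rewrite fineK // fin_num_measure //.
exact: measurable_regime_state.
Qed.

Let rate m i j n : R := expmx ((T / n.+1%:R) *: Q m) i j.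

Lemma regime_jump_prob m i j n l :
  P (regime_jump X phi m i j n l) =
  (regime_state_prob m i (grid T n l) * rate m i j n)%:E.
Proof.
have := @markov_step _ _ _ _ _ P _ _ _ _ _ hX m l (grid T n) predT i j
  (grid0 T n).
have -> : regime phi m `&` [set w | predT [ffun k : 'I_l.+1 => X (grid T n k) w]]
   = regime phi m by apply/seteqP; split=> w // [].
move=> ->; last by move=> k _; rewrite grid_lt.
rewrite gridS addrAC subrr add0r EFinM; congr (_ * _)%E.
by apply: regime_state_probE; exact: grid_ge0.
Qed.

Lemma mul_rate_le (x : \bar R) (r : R) : (0 <= x)%E ->
  (x * r%:E <= x * `|r|%:E)%E.
Proof. by move=> x0; apply: lee_wpmul2l => //; rewrite lee_fin ler_norm. Qed.

Lemma regime_jump_prob_le m i j n l :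
  (P (regime_jump X phi m i j n l) <= `|rate m i j n|%:E)%E.
Proof.
have mA := measurable_regime_state m i (grid_ge0 n l T0).
rewrite regime_jump_prob EFinM -regime_state_probE ?grid_ge0//.
apply: le_trans (mul_rate_le _ _) _ => //.
rewrite -[leRHS]mul1e; apply: lee_wpmul2r; first by rewrite lee_fin.
exact: probability_le1.
Qed.

(** In disjoint cells, the later transition costs a factor e_ij(h) given the
    earlier one.  The absolute value stands in for the nonnegativity of the
    entries of the exponential. *)
Lemma regime_jump2_prob_le m i j n l l' : (l < l')%N ->
  (P (regime_jump X phi m i j n l `&` regime_jump X phi m i j n l') <=
   (`|rate m i j n| ^+ 2)%:E)%E.
Proof.
move=> ll'.
pose b (c : {ffun 'I_l'.+1 -> 'I_p}) := (c (inord l) == i) && (c (inord l.+1) == j).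
pose B := [set w | b [ffun k : 'I_l'.+1 => X (grid T n k) w]].
have BE w : B w <-> X (grid T n l) w = i /\ X (grid T n l.+1) w = j.
  rewrite /B /b /= !ffunE !inordK ?ltnS // 1?ltnW //.
  by split=> [/andP[/eqP-> /eqP->]|[-> ->]]; rewrite ?eqxx.
have step := @markov_step _ _ _ _ _ P _ _ _ _ _ hX m l' (grid T n) b i j (grid0 T n).
have -> : regime_jump X phi m i j n l `&` regime_jump X phi m i j n l' =
    regime phi m `&` B `&` state X (grid T n l') i `&` state X (grid T n l'.+1) j.
  apply/seteqP; split=> w.
    by move=> [[[rw xl] xl1] [[_ xl'] xl'1]]; split=> //; split=> //; split=> //; apply/BE.
  by move=> [[[rw /BE[xl xl1]] xl'] xl'1].
rewrite step; last by move=> k _; rewrite grid_lt.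
rewrite gridS addrAC subrr add0r -/(rate m i j n).
apply: le_trans (mul_rate_le _ _) _ => //.
rewrite expr2 EFinM; apply: lee_wpmul2r; first by rewrite lee_fin.
apply: le_trans (regime_jump_prob_le m i j n l).
have jumpE : regime_jump X phi m i j n l = regime phi m `&` B.
  apply/seteqP; split=> w; first by move=> [[rw xl] xl1]; split=> //; apply/BE.
  by move=> [rw /BE[xl xl1]].
rewrite -jumpE; apply: le_measure; rewrite ?inE.
- apply: measurableI; first exact: measurable_regime_jump.
  by apply: (measurable_state_event hX); exact: grid_ge0.
- exact: measurable_regime_jump.
- exact: subIsetl.
Qed.

(** The second moment of the number of cells that go from i to j: the diagonal
    contributes (n+1)|e_ij(h)| and the pairs of distinct cells at most its
    square. *)
Lemma regime_jump_sq_le m i j n :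
  (\sum_(l < n.+1) \sum_(l' < n.+1)
     P (regime_jump X phi m i j n l `&` regime_jump X phi m i j n l') <=
   (n.+1%:R * `|rate m i j n| + (n.+1%:R * `|rate m i j n|) ^+ 2)%:E)%E.
Proof.
set e := `|rate m i j n|.
apply: (@le_trans _ _
  (\sum_(l < n.+1) \sum_(l' < n.+1) ((l == l')%:R * e + e ^+ 2)%:E)%E).
  apply: lee_sum => l _; apply: lee_sum => l' _.
  have [<-|ll'] := eqVneq l l'.
    rewrite setIid mul1r; apply: le_trans (regime_jump_prob_le _ _ _ _ _) _.
    by rewrite lee_fin lerDl sqr_ge0.
  rewrite mul0r add0r.
  have [lt|lt] := ltnP l l'; first exact: regime_jump2_prob_le.
  rewrite setIC; apply: regime_jump2_prob_le.
  by rewrite ltn_neqAle lt andbT eq_sym; apply: contraNneq ll' => /val_inj ->.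
under eq_bigr => l _.
  rewrite sumEFin big_split /= -mulr_suml (bigD1 l) //= eqxx big1; last first.
    by move=> l' /negbTE; rewrite eq_sym => ->.
  rewrite addr0 mul1r big_const_ord iter_addr_0; over.
rewrite sumEFin big_const_ord iter_addr_0 lee_fin -mulr_natl le_eqVlt.
by apply/orP; left; apply/eqP; rewrite -mulr_natl; ring.
Qed.

Definition driven_occupation m i w : R :=
  (phi w == m)%:R * occupation_time (fun t => X t w) T i.

Lemma driven_occupation_grid m i w :
  T / n.+1%:R * \sum_(l < n.+1) \1_(regime_state X phi m i (grid T n l.+1)) w
    @[n --> \oo] --> driven_occupation m i w.
Proof.
have -> : (fun n => T / n.+1%:R *
      \sum_(l < n.+1) \1_(regime_state X phi m i (grid T n l.+1)) w) =
    (fun n => (phi w == m)%:R *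
      (T / n.+1%:R * \sum_(l < n.+1) (X (grid T n l.+1) w == i)%:R)).
  apply/funext => n; rewrite mulrCA; congr (_ * _).
  by rewrite mulr_sumr; apply: eq_bigr => l _; rewrite indic_regime_state.
apply: cvgMl_tmp; apply: occupation_grid => //; exact: mixture_path hX w.
Qed.

(** The limit mu is E[Phi^(m) Z_i], by dominated convergence of the Riemann sums,
    bounded by T.  If it vanished, Phi^(m) Z_i would vanish almost surely,
    whereas it is positive on the event that X(t) = i and phi = m. *)
Lemma mean_occupation_cvg m i : exists2 mu : R,
  T / n.+1%:R * \sum_(l < n.+1) regime_state_prob m i (grid T n l.+1)
    @[n --> \oo] --> mu &
  (exists2 t, 0 <= t < T & (0 < P (regime_state X phi m i t))%E) -> 0 < mu.
Proof.
pose A (_ n l : nat) := regime_state X phi m i (grid T n l.+1).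
pose count n w : R := T / n.+1%:R * \sum_(l < n.+1) \1_(A 0%N n l) w.
have mA k n l : measurable (A k n l) by apply: measurable_regime_state; exact: grid_ge0.
have c0 n : 0 <= T / n.+1%:R by rewrite divr_ge0 // ltW.
have PA k n l : (l < n.+1)%N ->
    P (A k n l) = (regime_state_prob m i (grid T n l.+1))%:E.
  by move=> _; apply: regime_state_probE; exact: grid_ge0.
have Icount n := integral_count mA c0 PA 0%N n.
have count0 n w : 0 <= count n w by rewrite mulr_ge0 // sumr_ge0.
have countT n w : count n w <= T.
  rewrite /count mulrAC ler_pdivrMr ?ltr0n // ler_pM2l //.
  rewrite -[leRHS](_ : \sum_(l < n.+1) (1 : R) = _); last first.
    by rewrite big_const_ord iter_addr_0.
  by apply: ler_sum => l _; rewrite indicE lern1 leq_b1.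
have mcount n : measurable_fun setT (count n).
  apply: measurable_funM => //; apply: measurable_sum => l.
  exact: measurable_indic.
have countY w : count n w @[n --> \oo] --> driven_occupation m i w.
  exact: driven_occupation_grid.
have Y0 w : 0 <= driven_occupation m i w.
  rewrite -(cvg_lim (@Rhausdorff R) (@countY w)).
  apply: limr_ge; last exact: nearW.
  by apply/cvg_ex; eexists; exact: countY.
have mY : measurable_fun setT (driven_occupation m i).
  by apply: (measurable_fun_cvg (h := count)) => // w _; exact: countY.
have YT w : driven_occupation m i w <= T.
  rewrite -(cvg_lim (@Rhausdorff R) (@countY w)).
  apply: limr_le; last exact: nearW.
  by apply/cvg_ex; eexists; exact: countY.
have lim : (\int[P]_w (count n w)%:E)%E @[n --> \oo] -->
    (\int[P]_w (driven_occupation m i w)%:E)%E.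
  apply: (@dominated_cvg _ _ _ P setT measurableT
    (fun n w => (count n w)%:E) _ (cst T%:E)) => //.
  - by move=> n; exact/measurable_EFinP.
  - by move=> w _; apply: cvg_EFin; [exact: nearW|exact: countY].
  - exact: finite_measure_integrable_cst.
  - by move=> n w _; rewrite gee0_abs ?lee_fin.
have finY : (\int[P]_w (driven_occupation m i w)%:E)%E \is a fin_num.
  rewrite ge0_fin_numE; last by apply: integral_ge0 => w _; rewrite lee_fin.
  apply: (@le_lt_trans _ _ (\int[P]_w (cst T%:E w))%E); last first.
    by rewrite integral_cst//= probability_setT mule1 ltry.
  apply: ge0_le_integral => //.
  - by move=> w _; rewrite lee_fin.
  - exact/measurable_EFinP.
  - by move=> w _; rewrite lee_fin.
exists (fine (\int[P]_w (driven_occupation m i w)%:E)%E).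
  have -> : (fun n => T / n.+1%:R *
        \sum_(l < n.+1) regime_state_prob m i (grid T n l.+1)) =
      fine \o (fun n => \int[P]_w (count n w)%:E)%E.
    by apply/funext => n /=; rewrite Icount.
  by apply: fine_cvg; rewrite fineK.
move=> [t tT Pt]; have t0 : 0 <= t by case/andP: tT.
apply: fine_gt0; rewrite -ge0_fin_numE ?finY ?andbT; last first.
  by apply: integral_ge0 => w _; rewrite lee_fin.
rewrite lt_neqAle; apply/andP; split; last first.
  by apply: integral_ge0 => w _; rewrite lee_fin.
apply/negP => /eqP int0.
have mYE : measurable_fun setT (EFin \o driven_occupation m i).
  exact/measurable_EFinP.
have : ae_eq P setT (EFin \o driven_occupation m i) (cst 0%E).
  apply/ae_eq_integral_abs => //.
  by rewrite int0; apply: eq_integral => w _; rewrite gee0_abs // lee_fin.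
move=> [N [mN PN0 sub]].
suff : (P (regime_state X phi m i t) <= 0)%E by rewrite leNgt Pt.
rewrite -PN0; apply: le_measure; rewrite ?inE //.
  exact: measurable_regime_state.
move=> w [rw xt]; apply: sub => /= /(_ I) [] /eqP; apply/negP.
rewrite gt_eqF // /driven_occupation; move: rw; rewrite /regime /= => ->.
rewrite eqxx mul1r; apply: (occupation_time_gt0 T0 _ tT xt).
exact: mixture_path hX w.
Qed.

End OneProcess.
End GridEvents.

(** * Strong laws for the sample and the estimators *)

Section Ratios.
Context {R : realType}.

Lemma mean_cvg_neq0 (A : nat -> R) (a : R) : 0 < a ->
  N%:R^-1 * A N @[N --> \oo] --> a -> \forall N \near \oo, A N != 0.
Proof.
move=> a0 Aa; near=> N.
have : 0 < N%:R^-1 * A N by near: N; exact: (cvgr_gt _ Aa _ a0).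
by apply: contraTneq => ->; rewrite mulr0 ltxx.
Unshelve. all: by end_near.
Qed.

Lemma ratio_of_means_cvg (A B : nat -> R) (a b : R) : b != 0 ->
  N%:R^-1 * A N @[N --> \oo] --> a -> N%:R^-1 * B N @[N --> \oo] --> b ->
  A N / B N @[N --> \oo] --> a / b.
Proof.
move=> b0 Aa Bb.
have : (N%:R^-1 * A N) / (N%:R^-1 * B N) @[N --> \oo] --> a / b.
  by apply: cvgM => //; exact: cvgV.
apply: cvg_trans; apply: near_eq_cvg; near=> N.
have N0 : (N%:R : R) != 0 by rewrite pnatr_eq0 -lt0n; near: N; exact: nbhs_infty_gt.
by rewrite invfM invrK mulrACA mulVf // mul1r.
Unshelve. all: by end_near.
Qed.

End Ratios.

Section Sample.
Context {R : realType} {d : measure_display} {Omega : measurableType d}.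
Context {p M : nat} (P : probability Omega R).
Context (pi_ : 'I_p -> R) (s : 'I_p -> 'I_M -> R) (Q : 'I_M -> 'M[R]_p).
Context (X : R -> Omega -> 'I_p) (phi : Omega -> 'I_M).
Context (Xs : nat -> R -> Omega -> 'I_p) (phis : nat -> Omega -> 'I_M) (T : R).
Hypothesis T0 : 0 < T.
Hypothesis hX : mixture_process P pi_ s Q X phi.
Hypothesis hXs : forall k, mixture_process P pi_ s Q (Xs k) (phis k).
Hypothesis hind :
  mutually_independent P (fun k => observed_sigma (Xs k) (phis k)).

Lemma independent_events k k' B B' : k != k' ->
  observed_sigma (Xs k) (phis k) B -> observed_sigma (Xs k') (phis k') B' ->
  P (B `&` B') = (P B * P B')%E.
Proof.
move=> kk' oB oB'.
pose A q := if q == k then B else B'.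
have := hind (J := [fset k; k']%fset) (A := A).
have -> : \bigcap_(q in [set` [fset k; k']%fset]) A q = B `&` B'.
  apply/seteqP; split=> w /=.
    move=> h; split; first by have := h k; rewrite /A /= eqxx; apply; rewrite !inE eqxx.
    by have := h k'; rewrite /A /= eq_sym (negbTE kk'); apply; rewrite !inE eqxx orbT.
  by move=> [Bw B'w] q _; rewrite /A; case: ifP.
move=> ->.
  by rewrite big_fsetU1 ?inE //= big_seq_fset1 /A eqxx eq_sym (negbTE kk').
move=> q; rewrite !inE /A => /orP[/eqP->|/eqP->]; first by rewrite eqxx.
by rewrite eq_sym (negbTE kk').
Qed.

Lemma same_state_law k m i t : 0 <= t ->
  P (regime_state (Xs k) (phis k) m i t) =
  (regime_state_prob P X phi m i t)%:E.
Proof.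
move=> t0; rewrite -(regime_state_probE hX) //.
move: t0; rewrite le_eqVlt => /predU1P[<-|t0].
  by rewrite /regime_state (state_law0 (hXs k)) (state_law0 hX).
by rewrite /regime_state (state_law (hXs k)) // (state_law hX).
Qed.

Lemma double_sum_prob_le n (A : nat -> set Omega) :
  (forall l, measurable (A l)) ->
  (\sum_(l < n) \sum_(l' < n) P (A l `&` A l') <= (n%:R ^+ 2)%:E)%E.
Proof.
move=> mA; apply: (@le_trans _ _ (\sum_(l < n) \sum_(l' < n) 1%:E)%E).
  apply: lee_sum => l _; apply: lee_sum => l' _; apply: probability_le1.
  exact: measurableI.
under eq_bigr do rewrite sumEFin big_const_ord iter_addr_0.
by rewrite sumEFin big_const_ord iter_addr_0 -mulr_natl mulr1 expr2 mulr_natl lexx.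
Qed.

(** An indicator is the constant case of a sum of indicators: one term at each
    step, with weight 1. *)
Lemma strong_law_event (A : nat -> set Omega) (a : R) :
  (forall k, measurable (A k)) -> (forall k, P (A k) = a%:E) ->
  (forall k, observed_sigma (Xs k) (phis k) (A k)) ->
  {ae P, forall w, N%:R^-1 * \sum_(k < N) \1_(A k) w @[N --> \oo] --> a}.
Proof.
move=> mA PA oA.
refine (strong_law_limit_count (A := fun k _ _ => A k) (c := fun=> 1)
  (K := fun=> 1%N) (a := fun _ _ => a) (Y := fun k => \1_(A k)) (C := 1)
  _ _ _ _ _ _ _) => //.
- by move=> k w; under eq_fun do rewrite big_ord1 mul1r; exact: cvg_cst.
- by under eq_fun do rewrite big_ord1 mul1r; exact: cvg_cst.
- by move=> k n; rewrite expr1n mul1e !big_ord1; apply: probability_le1; exact: measurableI.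
- by move=> k k' _ _ _ kk'; apply: independent_events kk' _ _; exact: oA.
Qed.

Lemma strong_law_occupation m i (mu : R) :
  T / n.+1%:R * \sum_(l < n.+1) regime_state_prob P X phi m i (grid T n l.+1)
    @[n --> \oo] --> mu ->
  {ae P, forall w,
    N%:R^-1 * occupation_total Xs phis T N m i w @[N --> \oo] --> mu}.
Proof.
move=> mucvg.
refine (strong_law_limit_count
  (A := fun k n l => regime_state (Xs k) (phis k) m i (grid T n l.+1))
  (c := fun n => T / n.+1%:R) (K := S)
  (a := fun n l => regime_state_prob P X phi m i (grid T n l.+1))
  (Y := fun k w => driven_occupation T (Xs k) (phis k) m i w) (C := T ^+ 2)
  _ _ _ _ _ _ _).
- by move=> k n l; apply: (measurable_regime_state (hXs k)); exact: grid_ge0.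
- by move=> n; rewrite divr_ge0 // ltW.
- by move=> k n l _; apply: same_state_law; exact: grid_ge0.
- by move=> k w; apply: (driven_occupation_grid T0 (hXs k)).
- exact: mucvg.
- move=> k n; apply: (@le_trans _ _ (((T / n.+1%:R) ^+ 2)%:E * (n.+1%:R ^+ 2)%:E)%E).
    apply: lee_wpmul2l; first by rewrite lee_fin sqr_ge0.
    apply: (@double_sum_prob_le n.+1
      (fun l => regime_state (Xs k) (phis k) m i (grid T n l.+1))) => l.
    by apply: (measurable_regime_state (hXs k)); exact: grid_ge0.
  by rewrite -EFinM -exprMn divfK ?pnatr_eq0.
- move=> k k' n l l' kk'; apply: independent_events kk' _ _;
    by apply: observed_regime_state; exact: grid_ge0.
Qed.

(** Left and right Riemann sums differ by (f 0 - f T) h.  Occupation times are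
    sampled at right endpoints, while transitions start at left endpoints. *)
Lemma left_grid_mean (f : R -> R) (mu : R) :
  T / n.+1%:R * \sum_(l < n.+1) f (grid T n l.+1) @[n --> \oo] --> mu ->
  T / n.+1%:R * \sum_(l < n.+1) f (grid T n l) @[n --> \oo] --> mu.
Proof.
move=> mucvg.
have -> : (fun n => T / n.+1%:R * \sum_(l < n.+1) f (grid T n l)) =
    (fun n => T / n.+1%:R * \sum_(l < n.+1) f (grid T n l.+1) +
              T / n.+1%:R * (f 0 - f T)).
  apply/funext => n; rewrite -mulrDr; congr (_ * _).
  have := @big_ord_recl R 0 +%R n.+1 (fun l => f (grid T n l)).
  rewrite big_ord_recr /= grid_last grid0 => e.
  apply: (addIr (f T)); rewrite e addrA subrK addrC; congr (_ + _).
rewrite -[X in _ --> X]addr0; apply: cvgD => //.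
by rewrite -[X in _ --> X](mul0r (f 0 - f T)); apply: cvgMr_tmp; exact: mesh_cvg0.
Qed.

(** The mean of the grid count is e_ij(h) sum_l f(lh) with
    f(t) = P(phi = m, X(t) = i), that is (e_ij(h) / h) (h sum_l f(lh)), which
    tends to q_ij mu. *)
Lemma strong_law_transitions m i j (mu : R) : j != i ->
  T / n.+1%:R * \sum_(l < n.+1) regime_state_prob P X phi m i (grid T n l.+1)
    @[n --> \oo] --> mu ->
  {ae P, forall w, N%:R^-1 * (\sum_(k < N) (phis k w == m)%:R *
      (transitions (fun t => Xs k t w) T i j)%:R) @[N --> \oo] --> Q m i j * mu}.
Proof.
move=> ji mucvg.
pose e n := expmx ((T / n.+1%:R) *: Q m) i j.
have ecvg : n.+1%:R * e n @[n --> \oo] --> T * Q m i j by exact: expmx_rate.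
(* A convergent sequence is bounded, whence the second moment bound. *)
have [C Cb] : exists C, forall n,
    n.+1%:R * `|e n| + (n.+1%:R * `|e n|) ^+ 2 <= C.
  have /cvg_seq_bounded : cvgn (fun n => n.+1%:R * e n).
    by apply/cvg_ex; eexists; exact: ecvg.
  move=> /pinfty_ex_gt0[C C0 bC]; exists (C + C ^+ 2) => n.
  have := bC n I; rewrite /= normrM normr_nat => h.
  by apply: lerD => //; rewrite ler_pXn2r // nnegrE ?mulr_ge0 // ltW.
refine (strong_law_limit_count
  (A := fun k n l => regime_jump T (Xs k) (phis k) m i j n l)
  (c := fun=> 1) (K := S)
  (a := fun n l => regime_state_prob P X phi m i (grid T n l) * e n)
  (Y := fun k w => (phis k w == m)%:R *
      (transitions (fun t => Xs k t w) T i j)%:R) (C := C) _ _ _ _ _ _ _).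
- by move=> k n l; exact: (measurable_regime_jump T0 (hXs k)).
- by [].
- move=> k n l _; rewrite (regime_jump_prob T0 (hXs k)) !EFinM; congr (_ * _)%E.
  rewrite -(regime_state_probE (hXs k)) ?grid_ge0 //.
  by apply: same_state_law; exact: grid_ge0.
- move=> k w /=; under eq_fun do rewrite mul1r.
  apply: cvg_near_cst; near=> n.
  have <- : grid_transitions (fun t => Xs k t w) T n i j =
      transitions (fun t => Xs k t w) T i j.
    near: n; apply: transitions_grid => //; exact: mixture_path (hXs k) w.
  rewrite /grid_transitions natr_sum mulr_sumr.
  by apply: eq_bigr => l _; rewrite indic_regime_jump.
- have -> : (fun n => 1 * \sum_(l < n.+1)
        regime_state_prob P X phi m i (grid T n l) * e n) =
      (fun n => T^-1 * (n.+1%:R * e n) * (T / n.+1%:R *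
        \sum_(l < n.+1) regime_state_prob P X phi m i (grid T n l))).
    apply/funext => n; rewrite mul1r -mulr_suml.
    have : (n.+1%:R : R) != 0 by rewrite pnatr_eq0.
    move: (\sum_(_ < _) _) (e n) (n.+1%:R) => x y z z0.
    by field; rewrite z0 gt_eqF.
  apply: cvgM; last exact: left_grid_mean.
  rewrite -[X in _ --> X](mulKf (lt0r_neq0 T0)).
  exact: cvgMl_tmp.
- move=> k n; rewrite expr1n mul1e.
  apply: le_trans (regime_jump_sq_le T0 (hXs k) m i j n) _.
  by rewrite lee_fin; exact: Cb.
- move=> k k' n l l' kk'; apply: independent_events kk' _ _;
    exact: observed_regime_jump.
Unshelve. all: by end_near.
Qed.

End Sample.

Theorem theorem3p4 (R : realType) (d : measure_display)
    (Omega : measurableType d) (P : probability Omega R) (p M : nat)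
    (pi_ : 'I_p -> R) (s : 'I_p -> 'I_M -> R) (Q : 'I_M -> 'M[R]_p)
    (X : R -> Omega -> 'I_p) (phi : Omega -> 'I_M)
    (Xs : nat -> R -> Omega -> 'I_p) (phis : nat -> Omega -> 'I_M) (T : R)
    (hT : 0 < T)
    (hs : is_regime_law s)
    (hQ : forall m, is_intensity (Q m))
    (hX : mixture_process P pi_ s Q X phi)
    (hXs : forall k, mixture_process P pi_ s Q (Xs k) (phis k))
    (hind : mutually_independent P (fun k => observed_sigma (Xs k) (phis k)))
    (hpos : forall t i, 0 <= t -> (0 < P [set w | X t w = i])%E) :
  {ae P, forall w,
    [/\ forall m i,
          (exists2 t, 0 <= t < T & (0 < P [set w | X t w = i /\ phi w = m])%E) ->
          [/\ \forall N \near \oo, occupation_total Xs phis T N m i w != 0,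
              forall j, j != i ->
                q_hat Xs phis T N m i j w @[N --> \oo] --> Q m i j &
              q_exit_hat Xs phis T N m i w @[N --> \oo] --> exit_rate (Q m) i],
        forall i, \forall N \near \oo, initial_total Xs N i w != 0,
        forall m i, s_hat Xs phis N m i w @[N --> \oo] --> s i m &
        forall i, pi_hat Xs N i w @[N --> \oo] --> pi_ i]}.
Proof.
have pi_gt0 i : 0 < pi_ i by rewrite -lte_fin -(mixture_initial hX) hpos.
have [mu muP] : exists mu : 'I_M -> 'I_p -> R, forall m i,
    (T / n.+1%:R * \sum_(l < n.+1) regime_state_prob P X phi m i (grid T n l.+1)
      @[n --> \oo] --> mu m i) /\
    ((exists2 t, 0 <= t < T & (0 < P [set w | X t w = i /\ phi w = m])%E) ->
      0 < mu m i).
  have /choice[mu muP] : forall mi : 'I_M * 'I_p, exists mu : R,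
      (T / n.+1%:R * \sum_(l < n.+1)
        regime_state_prob P X phi mi.1 mi.2 (grid T n l.+1) @[n --> \oo] --> mu) /\
      ((exists2 t, 0 <= t < T &
         (0 < P [set w | X t w = mi.2 /\ phi w = mi.1])%E) -> 0 < mu).
    move=> [m i] /=; have [mu mucvg mupos] := mean_occupation_cvg hT hX m i.
    exists mu; split=> // -[t tT Pt]; apply: mupos; exists t => //.
    rewrite (_ : regime_state _ _ _ _ _ = [set w | X t w = i /\ phi w = m]) //.
    by apply/seteqP; split=> w [].
  by exists (fun m i => mu (m, i)) => m i; exact: muP (m, i).
have occ : {ae P, forall w, forall m i,
    N%:R^-1 * occupation_total Xs phis T N m i w @[N --> \oo] --> mu m i}.
  apply: filter_forall => m; apply: filter_forall => i.
  by apply: (strong_law_occupation hT hX hXs hind); case: (muP m i).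
have trans : {ae P, forall w, forall m i j, j != i ->
    N%:R^-1 * (\sum_(k < N) (phis k w == m)%:R *
      (transitions (fun t => Xs k t w) T i j)%:R) @[N --> \oo] -->
    Q m i j * mu m i}.
  apply: filter_forall => m; apply: filter_forall => i.
  apply: filter_forall => j.
  have [->|ji] := eqVneq j i; first exact: nearW.
  have := strong_law_transitions hT hX hXs hind ji (muP m i).1.
  by apply: filterS => w h _.
have init : {ae P, forall w, forall i, pi_hat Xs N i w @[N --> \oo] --> pi_ i}.
  apply: filter_forall => i.
  have := @strong_law_event _ _ _ _ _ P Xs phis hind
    (fun k => state (Xs k) 0 i) (pi_ i)
    (fun k => measurable_state_event (hXs k) i (lexx 0))
    (fun k => mixture_initial (hXs k) i)
    (fun k => @observed_state _ _ _ _ _ (Xs k) (phis k) 0 i (lexx 0)).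
  apply: filterS => w; rewrite /pi_hat /initial_total.
  under eq_fun do under eq_bigr do rewrite indicE in_state.
  by [].
have regs : {ae P, forall w, forall m i,
    N%:R^-1 * (\sum_(k < N) (phis k w == m)%:R * (Xs k 0 w == i)%:R)
      @[N --> \oo] --> s i m * pi_ i}.
  apply: filter_forall => m; apply: filter_forall => i.
  have := @strong_law_event _ _ _ _ _ P Xs phis hind
    (fun k => regime_state (Xs k) (phis k) m i 0) (s i m * pi_ i)
    (fun k => measurable_regime_state (hXs k) m i (lexx 0))
    (fun k => state_law0 (hXs k) m i)
    (fun k => @observed_regime_state _ _ _ _ _ (Xs k) (phis k) m i 0 (lexx 0)).
  apply: filterS => w.
  under eq_fun do under eq_bigr do rewrite indic_regime_state.
  by [].
(* The common factor mu m i, or pi_ i, cancels in each ratio of means. *)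
near=> w; split.
- move=> m i /(muP m i).2 mu0.
  have occw : N%:R^-1 * occupation_total Xs phis T N m i w @[N --> \oo] --> mu m i.
    by move: m i {mu0}; near: w.
  have rates j : j != i -> q_hat Xs phis T N m i j w @[N --> \oo] --> Q m i j.
    move=> ji; rewrite -[X in _ --> X](mulfK (lt0r_neq0 mu0)).
    apply: ratio_of_means_cvg => //; first by rewrite gt_eqF.
    by move: m i {mu0 occw} j ji; near: w.
  split=> //; first exact: (mean_cvg_neq0 mu0 occw).
  (* Exit rates are sums of transition rates, as are their estimators. *)
  have -> : (fun N => q_exit_hat Xs phis T N m i w) =
      (fun N => \sum_(j | j != i) q_hat Xs phis T N m i j w).
    apply/funext => N; rewrite /q_exit_hat /q_hat -mulr_suml; congr (_ / _).
    rewrite exchange_big /=; apply: eq_bigr => k _.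
    by rewrite /exits natr_sum mulr_sumr.
  have [_ _ Qsum] := hQ m; rewrite /exit_rate -Qsum.
  by apply: cvg_big => [|j ji]; [exact: add_continuous|exact: rates].
- move=> i; apply: (mean_cvg_neq0 (pi_gt0 i)).
  by move: i; near: w.
- move=> m i; rewrite -[X in _ --> X](mulfK (lt0r_neq0 (pi_gt0 i))).
  apply: ratio_of_means_cvg; first by rewrite gt_eqF.
    by move: m i; near: w.
  by move: i; near: w.
- by near: w.
Unshelve. all: by end_near.
Qed.
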